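(* Let $R$ be any commutative ring with a unique prime ideal $p$. Then every triangulated subcategory of $D^b(\operatorname{proj} R)$ is a triangulated ideal and is of the form $$\mathcal{D}_m=\{X\in D^b(\operatorname{proj} R):\Lambda(X)\equiv0\bmod m\}$$ for some non-negative integer $m$, where $\Lambda(X)=\sum_{i=-\infty}^{\infty}(-1)^i\dim_{R/p}H_i(X\otimes R/p)$.
   Context: All subcategories are full (and closed under isomorphism). $D^b(\operatorname{proj} R)$ is the chain homotopy category of perfect complexes, i.e. bounded complexes of finitely generated projective $R$-modules, a tensor triangulated category under $\otimes_R$. A triangulated ideal is a triangulated subcategory $\mathcal{C}$ such that $X\otimes Y\in\mathcal{C}$ for all $X\in\mathcal{C}$ and all $Y\in D^b(\operatorname{proj} R)$. Congruence modulo $0$ means equality.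
   Formalization: The claim ''is of the form D_m'' is made only for triangulated subcategories containing a nonzero object, since the zero subcategory is no D_m (every D_m contains the nonzero R ⊕ R[1], which has Λ = 0); the ideal claim covers all. *)

(* Defs.v *)
From HB Require Import structures.
From mathcomp Require Import all_boot all_order all_algebra.
From mathcomp Require Import generic_quotient ring_quotient.
From mathcomp Require Import boolp classical_sets functions cardinality fsbigop.
From mathcomp Require Import freeg.

Set Implicit Arguments.
Unset Strict Implicit.
Unset Printing Implicit Defensive.

Import GRing.Theory.

Local Notation "{ 'quot' I }" := (Quotient.quot I) : type_scope.
Local Open Scope ring_scope.
Local Open Scope quotient_scope.

Definition mk_linear (A : pzRingType) (V W : lmodType A) (f : V -> W)
    (Hf : linear f) : {linear V -> W} :=
  HB.pack f (GRing.isLinear.Build A V W *:%R f Hf).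

Record submodule (A : pzRingType) (V : lmodType A) := Submodule {
  smem :> V -> bool;
  smemP : submod_closed smem }.

HB.instance Definition _ (A : pzRingType) (V : lmodType A) (U : submodule V) :=
  GRing.isSubmodClosed.Build A V (smem U)
    (GRing.submod_closed_semi (smemP U)).

Section QuotMod.
Variables (A : pzRingType) (V : lmodType A) (U : submodule V).

Let Uz : zmodClosed V := GRing.ZmodClosed.clone V (smem U) _.
Definition quotmod : Type := {quot Uz}.
HB.instance Definition _ := GRing.Zmodule.on quotmod.

Definition qclass (x : V) : quotmod := \pi_{quot Uz} x.

Lemma qclassB : {morph qclass : x y / x - y}.
Proof. by move=> x y; rewrite /qclass raddfB. Qed.

Lemma qclass_eq x y : (qclass x == qclass y) = (x - y \in smem U).
Proof. by rewrite Quotient.idealrBE. Qed.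

Lemma qclass_surj (x : quotmod) : {y | qclass y = x}.
Proof. by exists (repr (x : {quot Uz})); rewrite /qclass reprK. Qed.

Definition qscale (a : A) (x : quotmod) : quotmod :=
  qclass (a *: repr (x : {quot Uz})).

Lemma qscaleE a x : qscale a (qclass x) = qclass (a *: x).
Proof.
apply/eqP; rewrite qclass_eq -scalerBr; apply: rpredZ.
by rewrite -qclass_eq; apply/eqP; rewrite /qclass reprK.
Qed.

Lemma qclassD : {morph qclass : x y / x + y}.
Proof. by move=> x y; rewrite /qclass raddfD. Qed.

Lemma qscaleA a b x : qscale a (qscale b x) = qscale (a * b) x.
Proof. by have [y <-] := qclass_surj x; rewrite !qscaleE scalerA. Qed.
Lemma qscale1 : left_id 1 qscale.
Proof. by move=> x; have [y <-] := qclass_surj x; rewrite qscaleE scale1r. Qed.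
Lemma qscaleDr : right_distributive qscale +%R.
Proof.
move=> a x y; have [x' <-] := qclass_surj x; have [y' <-] := qclass_surj y.
by rewrite -qclassD !qscaleE -qclassD scalerDr.
Qed.
Lemma qscaleDl x : {morph qscale^~ x : a b / a + b}.
Proof.
by move=> a b; have [y <-] := qclass_surj x; rewrite !qscaleE -qclassD scalerDl.
Qed.
HB.instance Definition _ := GRing.Zmodule_isLmodule.Build A quotmod
  qscaleA qscale1 qscaleDr qscaleDl.

Lemma qclass_linear : linear qclass.
Proof. by move=> a x y; rewrite qclassD -qscaleE. Qed.
HB.instance Definition _ := GRing.isLinear.Build A V quotmod *:%R qclass
  qclass_linear.

Section Lift.
Variables (W : lmodType A) (f : {linear V -> W}).
Hypothesis fU : forall x, x \in smem U -> f x = 0.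

Definition qlift_fun (x : quotmod) : W := f (repr (x : {quot Uz})).

Lemma qlift_funE x : qlift_fun (qclass x) = f x.
Proof.
apply/eqP; rewrite -subr_eq0 -raddfB; apply/eqP/fU.
by rewrite -qclass_eq; apply/eqP; rewrite /qclass reprK.
Qed.

Lemma qlift_linear : linear qlift_fun.
Proof.
move=> a x y; have [x' <-] := qclass_surj x; have [y' <-] := qclass_surj y.
by rewrite -linearP !qlift_funE linearP.
Qed.

Definition qlift : {linear quotmod -> W} := mk_linear qlift_linear.

Lemma qliftE x : qlift (qclass x) = f x. Proof. exact: qlift_funE. Qed.
End Lift.
End QuotMod.

Section Tensor.
Variables (A : comNzRingType).

Section TensorDef.
Variables (M N : lmodType A).

Local Notation free := {freeg (M * N)%type / A}.
Local Notation "[g x , y ]" := ([freeg [:: (1, (x, y))]] : free)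
  (at level 0).

Definition tens_gen (z : free) : Prop :=
  [\/ exists a m m' n, z = [g a *: m + m', n] - (a *: [g m, n] + [g m', n])
    | exists a m n n', z = [g m, a *: n + n'] - (a *: [g m, n] + [g m, n'])].

Definition tens_rel (z : free) : bool :=
  `[< forall S : submodule free, (forall y, tens_gen y -> S y) -> S z >].

Lemma tens_rel_closed : submod_closed tens_rel.
Proof.
split=> [|a x y /asboolP Sx /asboolP Sy]; apply/asboolP => S gS.
  exact: rpred0.
by apply: rpredD; [apply: rpredZ; apply: Sx | apply: Sy].
Qed.

Definition tens : Type := quotmod (Submodule tens_rel_closed).
HB.instance Definition _ := GRing.Lmodule.on tens.

Definition tpure (m : M) (n : N) : tens := qclass _ [g m, n].


Lemma tpureDl a m m' n : tpure (a *: m + m') n = a *: tpure m n + tpure m' n.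
Proof.
rewrite /tpure -linearP; apply/eqP; rewrite qclass_eq; apply/asboolP => S.
by apply; left; exists a, m, m', n.
Qed.

Lemma tpureDr a m n n' : tpure m (a *: n + n') = a *: tpure m n + tpure m n'.
Proof.
rewrite /tpure -linearP; apply/eqP; rewrite qclass_eq; apply/asboolP => S.
by apply; right; exists a, m, n, n'.
Qed.

Lemma free_ext (W : lmodType A) (f g : {linear free -> W}) :
  (forall m n, f [g m, n] = g [g m, n]) -> f =1 g.
Proof.
move=> fg z; rewrite -(freeg_sumE z) !linear_sum; apply: eq_bigr => -[m n] _.
have -> : << coeff (m, n) z *g (m, n) >> = coeff (m, n) z *: [g m, n].
  apply/eqP/freeg_eqP => x.
  by rewrite coeffZ !coeffU mul1r.
by rewrite !linearZ fg.
Qed.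

Lemma tens_ext (W : lmodType A) (f g : {linear tens -> W}) :
  (forall m n, f (tpure m n) = g (tpure m n)) -> f =1 g.
Proof.
move=> fg z; have [y <-] := qclass_surj z.
exact: (@free_ext W (f \o qclass _) (g \o qclass _)).
Qed.

Section Lift.
Variables (W : lmodType A) (b : M -> N -> W).
Hypothesis bl : forall n, linear (b^~ n).
Hypothesis br : forall m, linear (b m).

Let lift0 : free -> W := fglift (fun z => b z.1 z.2).

Lemma lift0D x y : lift0 (x - y) = lift0 x - lift0 y.
Proof. exact: lift_is_additive. Qed.

Lemma lift0_linear : linear lift0.
Proof.
have add0 : {morph lift0 : x y / x + y}.
  move=> x y; have l0 : lift0 0 = 0 by rewrite -(subrr 0) lift0D subrr.
  by rewrite -{1}(opprK y) lift0D -{1}(sub0r y) lift0D l0 sub0r opprK.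
have sum0 (I : Type) (r : seq I) F :
    lift0 (\sum_(i <- r) F i) = \sum_(i <- r) lift0 (F i).
  elim: r => [|i r IH]; last by rewrite !big_cons add0 IH.
  by rewrite !big_nil -(subrr 0) lift0D subrr.
have lU c k : lift0 << c *g k >> = c *: b k.1 k.2 by rewrite /lift0 liftU.
move=> a x y; rewrite add0; congr (_ + _).
rewrite -(freeg_sumE x) scaler_sumr !sum0 scaler_sumr; apply: eq_bigr => k _.
have -> : a *: << coeff k x *g k >> = << a * coeff k x *g k >>.
  by apply/eqP/freeg_eqP => j; rewrite coeffZ !coeffU mulrA.
by rewrite !lU scalerA.
Qed.

Let lift1 : {linear free -> W} := mk_linear lift0_linear.

Lemma lift1U m n : lift1 [g m, n] = b m n.
Proof. by rewrite /= /lift0 liftU scale1r. Qed.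

Lemma lift1_rel_closed : submod_closed (fun z => lift1 z == 0).
Proof.
split=> [|a x y]; first by rewrite unfold_in linear0.
rewrite !unfold_in => /eqP x0 /eqP y0.
by rewrite linearP x0 y0 scaler0 addr0.
Qed.

Lemma lift1_rel z : z \in smem (Submodule tens_rel_closed) -> lift1 z = 0.
Proof.
move=> /asboolP /(_ (Submodule lift1_rel_closed)) h; apply/eqP; apply: h => y.
case=> [[a [m [m' [n ->]]]]|[a [m [n [n' ->]]]]]; apply/eqP.
  by rewrite linearB linearP !lift1U bl subrr.
by rewrite linearB linearP !lift1U br subrr.
Qed.

Definition tlift (z : tens) : W := qlift lift1_rel z.

Lemma tlift_linear : linear tlift. Proof. exact: linearP. Qed.
HB.instance Definition _ := GRing.isLinear.Build A tens W *:%R tlift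
  tlift_linear.

Lemma tliftE m n : tlift (tpure m n) = b m n.
Proof. by rewrite /tlift qliftE lift1U. Qed.
End Lift.
End TensorDef.

Section TensorMap.
Variables (M N M' N' : lmodType A).
Variables (f : {linear M -> M'}) (g : {linear N -> N'}).

Let b m n := tpure (f m) (g n).
Lemma tmap_linl n : linear (b^~ n).
Proof. by move=> a x y; rewrite /b linearP tpureDl. Qed.
Lemma tmap_linr m : linear (b m).
Proof. by move=> a x y; rewrite /b linearP tpureDr. Qed.

Definition tmap (z : tens M N) : tens M' N' := tlift tmap_linl tmap_linr z.

Lemma tmap_linear : linear tmap. Proof. exact: linearP. Qed.
HB.instance Definition _ := GRing.isLinear.Build A (tens M N) (tens M' N') *:%R
  tmap tmap_linear.

Lemma tmapE m n :
  tmap (tpure m n) = tpure (f m) (g n).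
Proof. exact: tliftE. Qed.
End TensorMap.
End Tensor.

Arguments tlift : simpl never.
Arguments tpure : simpl never.
Arguments tmap : simpl never.

Section TensorMapTheory.
Variables (A : comNzRingType).

Lemma tpureZr (M N : lmodType A) a (m : M) (n : N) :
  tpure m (a *: n) = a *: tpure m n.
Proof.
have /eqP t0 : tpure m (0 : N) == 0.
  have := tpureDr 1 m (0 : N) 0; rewrite !scale1r addr0 => /eqP.
  by rewrite -subr_eq0 opprD addNKr oppr_eq0.
by have := tpureDr a m n 0; rewrite t0 !addr0.
Qed.

Lemma tpureZl (M N : lmodType A) a (m : M) (n : N) :
  tpure (a *: m) n = a *: tpure m n.
Proof.
have /eqP t0 : tpure (0 : M) n == 0.
  have := tpureDl 1 (0 : M) 0 n; rewrite !scale1r addr0 => /eqP.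
  by rewrite -subr_eq0 opprD addNKr oppr_eq0.
by have := tpureDl a m 0 n; rewrite t0 !addr0.
Qed.

Lemma tpure0l (M N : lmodType A) (n : N) : tpure (0 : M) n = 0.
Proof. by rewrite -{1}(scale0r 0) tpureZl scale0r. Qed.

Lemma tpure0r (M N : lmodType A) (m : M) : tpure m (0 : N) = 0.
Proof. by rewrite -{1}(scale0r 0) tpureZr scale0r. Qed.

Lemma tmap_comp (M N M' N' M'' N'' : lmodType A)
    (f : {linear M -> M'}) (g : {linear N -> N'})
    (f' : {linear M' -> M''}) (g' : {linear N' -> N''})
    (F : {linear M -> M''}) (G : {linear N -> N''}) :
  (forall m, F m = f' (f m)) -> (forall n, G n = g' (g n)) ->
  forall z, tmap f' g' (tmap f g z) = tmap F G z.
Proof.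
move=> eF eG; apply: (@tens_ext _ _ _ _ (tmap f' g' \o tmap f g)) => m n /=.
by rewrite !tmapE eF eG.
Qed.

Lemma tmap_eq0l (M N M' N' : lmodType A) (f : {linear M -> M'})
    (g : {linear N -> N'}) :
  (forall m, f m = 0) -> forall z, tmap f g z = 0.
Proof.
by move=> f0; apply: (@tens_ext _ _ _ _ (tmap f g) (\0)) => m n; rewrite /= tmapE f0 tpure0l.
Qed.

Lemma tmap_eq0r (M N M' N' : lmodType A) (f : {linear M -> M'})
    (g : {linear N -> N'}) :
  (forall n, g n = 0) -> forall z, tmap f g z = 0.
Proof.
by move=> g0; apply: (@tens_ext _ _ _ _ (tmap f g) (\0)) => m n; rewrite /= tmapE g0 tpure0r.
Qed.

Lemma tmap_comp0l (M N M' N' M'' N'' : lmodType A)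
    (f : {linear M -> M'}) (g : {linear N -> N'})
    (f' : {linear M' -> M''}) (g' : {linear N' -> N''}) :
  (forall m, f' (f m) = 0) -> forall z, tmap f' g' (tmap f g z) = 0.
Proof.
move=> e0 z; rewrite (@tmap_comp _ _ _ _ _ _ f g f' g' (f' \o f) (g' \o g)) //.
exact: tmap_eq0l.
Qed.

Lemma tmap_comp0r (M N M' N' M'' N'' : lmodType A)
    (f : {linear M -> M'}) (g : {linear N -> N'})
    (f' : {linear M' -> M''}) (g' : {linear N' -> N''}) :
  (forall n, g' (g n) = 0) -> forall z, tmap f' g' (tmap f g z) = 0.
Proof.
move=> e0 z; rewrite (@tmap_comp _ _ _ _ _ _ f g f' g' (f' \o f) (g' \o g)) //.
exact: tmap_eq0r.
Qed.

Lemma tmap_id (M N : lmodType A) (f : {linear M -> M}) (g : {linear N -> N}) :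
  (forall m, f m = m) -> (forall n, g n = n) -> forall z, tmap f g z = z.
Proof.
by move=> ef eg; apply: (@tens_ext _ _ _ _ (tmap f g) idfun) => m n; rewrite /= tmapE ef eg.
Qed.
End TensorMapTheory.

Section ExtensionOfScalars.
Variables (A B : comNzRingType) (phi : {rmorphism A -> B}).

(* [B] as an [A]-module through [phi] *)
Definition restr : Type := B.
HB.instance Definition _ := GRing.Zmodule.on restr.

Definition restr_scale (a : A) (b : restr) : restr := (phi a * b : B).

Lemma restr_scaleA a b x : restr_scale a (restr_scale b x) = restr_scale (a * b) x.
Proof. by rewrite /restr_scale rmorphM mulrA. Qed.
Lemma restr_scale1 : left_id 1 restr_scale.
Proof. by move=> x; rewrite /restr_scale rmorph1 mul1r. Qed.
Lemma restr_scaleDr : right_distributive restr_scale +%R.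
Proof. by move=> a x y; rewrite /restr_scale mulrDr. Qed.
Lemma restr_scaleDl x : {morph restr_scale^~ x : a b / a + b}.
Proof. by move=> a b; rewrite /restr_scale rmorphD mulrDl. Qed.
HB.instance Definition _ := GRing.Zmodule_isLmodule.Build A restr
  restr_scaleA restr_scale1 restr_scaleDr restr_scaleDl.

Lemma restr_mul_linear (b : B) : linear (fun x : restr => (b * (x : B) : restr)).
Proof. by move=> a x y; rewrite mulrDr /GRing.scale /= /restr_scale mulrCA. Qed.

Definition restr_mul b : {linear restr -> restr} := mk_linear (restr_mul_linear b).

Section Module.
Variable (M : lmodType A).

Definition ext_scalars : Type := tens M restr.
HB.instance Definition _ := GRing.Zmodule.on ext_scalars.

Definition ext_scale (b : B) (z : ext_scalars) : ext_scalars :=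
  tmap idfun (restr_mul b) z.

Lemma ext_scaleA a b x : ext_scale a (ext_scale b x) = ext_scale (a * b) x.
Proof. by apply: tmap_comp => //= n; rewrite mulrA. Qed.
Lemma ext_scale1 : left_id 1 ext_scale.
Proof. by apply: tmap_id => //= n; rewrite mul1r. Qed.
Lemma ext_scaleDr : right_distributive ext_scale +%R.
Proof. by move=> a x y; rewrite /ext_scale linearD. Qed.
Lemma ext_scaleDl x : {morph ext_scale^~ x : a b / a + b}.
Proof.
move=> a b; rewrite /ext_scale.
apply: (@tens_ext _ _ _ _ (tmap idfun (restr_mul (a + b)))
          (tmap idfun (restr_mul a) \+ tmap idfun (restr_mul b))) => m n /=.
rewrite !tmapE /= mulrDl.
by have := tpureDr 1 m (a * n : restr) (b * n : restr); rewrite !scale1r.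
Qed.
HB.instance Definition _ := GRing.Zmodule_isLmodule.Build B ext_scalars
  ext_scaleA ext_scale1 ext_scaleDr ext_scaleDl.
End Module.

Section Map.
Variables (M N : lmodType A) (f : {linear M -> N}).

Definition ext_map_fun (z : ext_scalars M) : ext_scalars N := tmap f idfun z.

Lemma ext_map_linear : linear ext_map_fun.
Proof.
move=> b x y; rewrite /ext_map_fun linearD; congr (_ + _).
rewrite [LHS](@tmap_comp _ _ _ _ _ _ _ _ _ _ _ f (restr_mul b)) //.
by rewrite [RHS](@tmap_comp _ _ _ _ _ _ _ _ _ _ _ f (restr_mul b)).
Qed.

Definition ext_map : {linear ext_scalars M -> ext_scalars N} :=
  mk_linear ext_map_linear.
End Map.
End ExtensionOfScalars.

Section DirectSum.
Variables (A : pzRingType) (I : Type) (V : I -> lmodType A).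

Record dsum : Type := DSum {
  dval :> forall i, V i;
  dvalP : finite_set [set i | dval i != 0] }.

Lemma dsumP (x y : dsum) : (forall i, x i = y i) -> x = y.
Proof.
case: x y => [f fP] [g gP] /= fg; have e : f = g by apply: functional_extensionality_dep.
by subst g; congr DSum; apply: Prop_irrelevance.
Qed.

HB.instance Definition _ := gen_eqMixin dsum.
HB.instance Definition _ := gen_choiceMixin dsum.

Lemma dsum0_subproof : finite_set [set i | (0 : V i) != 0].
Proof.
by rewrite (_ : [set i | _]%classic = classical_sets.set0) //; apply/seteqP; split=> i //=; rewrite eqxx.
Qed.
Definition dsum0 := DSum dsum0_subproof.

Lemma dsumD_subproof (x y : dsum) : finite_set [set i | x i + y i != 0].
Proof.
apply: (@sub_finite_set _ _ ([set i | x i != 0] `|` [set i | y i != 0])%classic).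
  move=> i /=; have [->|] := eqVneq (x i) 0; last by left.
  by rewrite add0r; right.
by rewrite finite_setU; split; apply: dvalP.
Qed.
Definition dsumD x y := DSum (dsumD_subproof x y).

Lemma dsumZ_subproof a (x : dsum) : finite_set [set i | a *: x i != 0].
Proof.
apply: (sub_finite_set _ (dvalP x)) => i /=; apply: contra_neq => ->.
exact: scaler0.
Qed.
Definition dsumZ a x := DSum (dsumZ_subproof a x).

Lemma dsumN_subproof (x : dsum) : finite_set [set i | - x i != 0].
Proof. by apply: (sub_finite_set _ (dvalP x)) => i /=; rewrite oppr_eq0. Qed.
Definition dsumN x := DSum (dsumN_subproof x).

Lemma dsumA : associative dsumD.
Proof. by move=> x y z; apply: dsumP => i /=; rewrite addrA. Qed.
Lemma dsumC : commutative dsumD.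
Proof. by move=> x y; apply: dsumP => i /=; rewrite addrC. Qed.
Lemma dsum0D : left_id dsum0 dsumD.
Proof. by move=> x; apply: dsumP => i /=; rewrite add0r. Qed.
Lemma dsumND : left_inverse dsum0 dsumN dsumD.
Proof. by move=> x; apply: dsumP => i /=; rewrite addNr. Qed.
HB.instance Definition _ := GRing.isZmodule.Build dsum dsumA dsumC dsum0D dsumND.

Lemma dsumZA a b x : dsumZ a (dsumZ b x) = dsumZ (a * b) x.
Proof. by apply: dsumP => i /=; rewrite scalerA. Qed.
Lemma dsumZ1 : left_id 1 dsumZ.
Proof. by move=> x; apply: dsumP => i /=; rewrite scale1r. Qed.
Lemma dsumZDr : right_distributive dsumZ +%R.
Proof. by move=> a x y; apply: dsumP => i /=; rewrite scalerDr. Qed.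
Lemma dsumZDl x : {morph dsumZ^~ x : a b / a + b}.
Proof. by move=> a b; apply: dsumP => i /=; rewrite scalerDl. Qed.
HB.instance Definition _ := GRing.Zmodule_isLmodule.Build A dsum
  dsumZA dsumZ1 dsumZDr dsumZDl.
End DirectSum.

Section Complexes.
Variable (A : comNzRingType).

(* Homological grading.  The differential is given as a family indexed by all
   pairs of degrees, vanishing unless [i = j + 1]; this avoids transporting
   along equalities of degrees. *)
Record complex := Complex {
  cob :> int -> lmodType A;
  cdiff : forall i j, {linear cob i -> cob j};
  cdiff_shape : forall i j, i != j + 1 -> forall x, cdiff i j x = 0;
  cdiff_sq : forall i j k x, cdiff j k (cdiff i j x) = 0 }.

Record chain_map (X Y : complex) := ChainMap {
  cmap :> forall i, {linear X i -> Y i};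
  cmap_diff : forall i j x, cmap j (cdiff X i j x) = cdiff Y i j (cmap i x) }.

Definition idc_comm (X : complex) i j (x : X i) :
  idfun (cdiff X i j x) = cdiff X i j (idfun x) := erefl.
Definition idc (X : complex) : chain_map X X :=
  @ChainMap X X (fun i => idfun) (@idc_comm X).

Lemma zeroc_comm (X Y : complex) i j (x : X i) :
  \0 (cdiff X i j x) = cdiff Y i j ((\0 : X i -> Y i) x).
Proof. by rewrite linear0. Qed.
Definition zeroc (X Y : complex) : chain_map X Y :=
  @ChainMap X Y (fun i => \0) (@zeroc_comm X Y).

Lemma compc_comm (X Y Z : complex) (g : chain_map Y Z) (f : chain_map X Y)
    i j (x : X i) :
  (g j \o f j) (cdiff X i j x) = cdiff Z i j ((g i \o f i) x).
Proof. by rewrite /= !cmap_diff. Qed.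
Definition compc (X Y Z : complex) (g : chain_map Y Z) (f : chain_map X Y) :
    chain_map X Z :=
  @ChainMap X Z (fun i => g i \o f i) (@compc_comm X Y Z g f).

Definition homotopic (X Y : complex) (f g : chain_map X Y) : Prop :=
  exists h : forall i j, {linear X i -> Y j}, forall i (x : X i),
    f i x - g i x = cdiff Y (i + 1) i (h i (i + 1) x)
                    + h (i - 1) i (cdiff X i (i - 1) x).

Definition homotopy_equivalent (X Y : complex) : Prop :=
  exists (f : chain_map X Y) (g : chain_map Y X),
    homotopic (compc g f) (idc X) /\ homotopic (compc f g) (idc Y).

(* zero object of the homotopy category *)
Definition zero_object (X : complex) : Prop := homotopic (idc X) (zeroc X X).

Definition finitely_generated (M : lmodType A) : Prop :=
  exists n (g : 'I_n -> M), forall x,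
    exists a : 'I_n -> A, x = \sum_i a i *: g i.

Definition projective (P : lmodType A) : Prop :=
  forall (M N : lmodType A) (e : {linear M -> N}) (f : {linear P -> N}),
    (forall y, exists x, e x = y) ->
    exists f' : {linear P -> M}, forall x, e (f' x) = f x.

Definition bounded (X : complex) : Prop :=
  exists n : nat, forall i : int, (n < absz i)%N -> forall x : X i, x = 0.

Definition perfect (X : complex) : Prop :=
  bounded X /\ forall i, finitely_generated (X i) /\ projective (X i).

Section Shift.
Variable X : complex.
Let V i := X (i - 1).
Definition shift_diff i j : {linear V i -> V j} :=
  \- (cdiff X (i - 1) (j - 1)).
Lemma shift_shape i j : i != j + 1 -> forall x, shift_diff i j x = 0.
Proof.
move=> ij x; rewrite /= cdiff_shape ?oppr0 //.
by rewrite addrAC (inj_eq (addIr _)).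
Qed.
Lemma shift_sq i j k x : shift_diff j k (shift_diff i j x) = 0.
Proof. by rewrite /= linearN cdiff_sq !oppr0. Qed.
Definition shift : complex := Complex shift_shape shift_sq.
End Shift.

(* The identity of [V i] if [i = j], and zero otherwise. *)
Definition same_degree (V : int -> lmodType A) i j (x : V i) : V j :=
  match i =P j with
  | ReflectT e => eq_rect i (fun k => V k) x j e
  | ReflectF _ => 0
  end.
Arguments same_degree : clear implicits.
Arguments same_degree : simpl never.

Lemma same_degreeE (V : int -> lmodType A) i (x : V i) : same_degree V i i x = x.
Proof.
rewrite /same_degree; case: eqP => // e.
by rewrite (eq_irrelevance e erefl).
Qed.

Lemma same_degree0 (V : int -> lmodType A) i j (x : V i) :
  i != j -> same_degree V i j x = 0.
Proof. by rewrite /same_degree; case: eqP. Qed.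

Lemma same_degree_linear (V : int -> lmodType A) i j :
  linear (same_degree V i j).
Proof.
have [e|ij] := eqVneq i j; first by subst j => a x y; rewrite !same_degreeE.
by move=> a x y; rewrite !same_degree0 // scaler0 addr0.
Qed.
HB.instance Definition _ (V : int -> lmodType A) i j :=
  GRing.isLinear.Build A (V i) (V j) *:%R (same_degree V i j)
    (@same_degree_linear V i j).

Lemma same_degree_diff (X : complex) (a b c d : int) (x : X a) : b = c + 1 ->
  cdiff X b d (same_degree X a b x) = same_degree X c d (cdiff X a c x).
Proof.
move=> ->; have [e|ab] := eqVneq a (c + 1); last first.
  by rewrite same_degree0 // linear0 cdiff_shape // linear0.
subst a; rewrite same_degreeE; have [e|cd] := eqVneq c d.
  by subst d; rewrite same_degreeE.
by rewrite same_degree0 // cdiff_shape // (inj_eq (addIr _)).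
Qed.

Section Cone.
Variables (X Y : complex) (f : chain_map X Y).
Let V (i : int) : lmodType A := (X (i - 1) * Y i)%type.

Definition cone_diff_fun i j (z : V i) : V j :=
  (- cdiff X (i - 1) (j - 1) z.1,
   same_degree Y (i - 1) j (f (i - 1) z.1) + cdiff Y i j z.2).

Lemma cone_diff_linear i j : linear (@cone_diff_fun i j).
Proof.
move=> a [x y] [x' y']; rewrite /cone_diff_fun /=; apply/pair_eqP/andP; split.
  by rewrite /= linearP opprD scalerN.
by rewrite /= !linearP scalerDr addrACA.
Qed.
Definition cone_diff i j : {linear V i -> V j} :=
  mk_linear (@cone_diff_linear i j).

Lemma cone_shape i j : i != j + 1 -> forall z, cone_diff i j z = 0.
Proof.
move=> ij [x y]; rewrite /= /cone_diff_fun /=.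
rewrite !cdiff_shape //; last by rewrite addrAC (inj_eq (addIr _)).
by rewrite same_degree0 ?addr0 ?oppr0 // subr_eq.
Qed.

Lemma cone_sq i j k z : cone_diff j k (cone_diff i j z) = 0.
Proof.
rewrite /= /cone_diff_fun /=; apply/pair_eqP/andP; split=> /=.
  by rewrite linearN cdiff_sq !oppr0.
rewrite !linearN linearD cdiff_sq addr0 cmap_diff.
by rewrite (@same_degree_diff Y _ _ (j - 1)) ?subrK // addNr.
Qed.

Definition cone : complex := Complex cone_shape cone_sq.
End Cone.

(* [(X (x) Y)_n] is the direct sum over [i] of [X_i (x) Y_(n-i)], with
   [d (x (x) y) = d x (x) y + (-1)^i x (x) d y] for [x] of degree [i]; the
   degree [i] summand of the differential therefore receives contributions from
   the summands of degrees [i] and [i + 1]. *)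
Section TensorComplex.
Variables (X Y : complex).
Let V (n : int) : lmodType A := dsum (fun i : int => tens (X i) (Y (n - i))).

Definition tensc_comp n m (z : V n) (i : int) : tens (X i) (Y (m - i)) :=
  (-1) ^+ absz i *: tmap idfun (cdiff Y (n - i) (m - i)) (z i)
  + tmap (cdiff X (i + 1) i) (same_degree Y (n - (i + 1)) (m - i)) (z (i + 1)).

Lemma tensc_finite n m (z : V n) :
  finite_set [set i | @tensc_comp n m z i != 0].
Proof.
have fS := dvalP z; set S := [set i | _]%classic in fS.
apply: (@sub_finite_set _ _ (S `|` [set i - 1 | i in S])%classic).
  move=> i /=; have [z0|z0 _] := eqVneq (z i) 0; last by left.
  have [z1|z1 _] := eqVneq (z (i + 1)) 0; last first.
    by right; exists (i + 1) => //; rewrite addrK.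
  by rewrite /tensc_comp z0 z1 !linear0 addr0 eqxx.
by rewrite finite_setU; split=> //; apply: finite_image.
Qed.

Definition tensc_diff_fun n m (z : V n) : V m := DSum (@tensc_finite n m z).

Lemma tensc_diff_linear n m : linear (@tensc_diff_fun n m).
Proof.
move=> a x y; apply: dsumP => i /=.
rewrite /tensc_comp /= (linearP (tmap idfun (cdiff Y (n - i) (m - i)))).
rewrite (linearP (tmap (cdiff X (i + 1) i)
  (same_degree Y (n - (i + 1)) (m - i)))) /=.
by rewrite !scalerDr !scalerA [a * _]mulrC addrACA.
Qed.
Definition tensc_diff n m : {linear V n -> V m} :=
  mk_linear (@tensc_diff_linear n m).

Lemma tensc_shape n m : n != m + 1 -> forall z, tensc_diff n m z = 0.
Proof.
move=> nm z; apply: dsumP => i /=; rewrite /tensc_comp.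
rewrite tmap_eq0r => [|y]; last first.
  by rewrite cdiff_shape // addrAC (inj_eq (addIr _)).
rewrite scaler0 add0r tmap_eq0r // => y.
by rewrite /= same_degree0 // opprD [- i - 1]addrC addrA (inj_eq (addIr _)) subr_eq.
Qed.

Lemma sign_int_succ (i : int) :
  (-1) ^+ absz (i + 1) = - (-1) ^+ absz i :> A.
Proof.
case: i => [i|[|i]]; first by rewrite -PoszD addn1 exprS mulN1r.
  by rewrite expr1 opprK.
have -> : Negz i.+1 + 1 = Negz i by rewrite !NegzE -addn1 PoszD opprD addrNK.
by rewrite /= [in RHS]exprS mulN1r opprK.
Qed.

Lemma tensc_sq n m k z : tensc_diff m k (tensc_diff n m z) = 0.
Proof.
apply: dsumP => i /=; rewrite /tensc_comp /= /tensc_comp.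
rewrite !linearD !linearZ /= tmap_comp0r; last by move=> y; rewrite cdiff_sq.
rewrite !scaler0 add0r [X in _ + (_ + X)]tmap_comp0l ?addr0; last first.
  by move=> y; rewrite cdiff_sq.
pose F : {linear X (i + 1) -> X i} := cdiff X (i + 1) i.
pose G : {linear Y (n - (i + 1)) -> Y (k - i)} :=
  cdiff Y (m - i) (k - i) \o same_degree Y (n - (i + 1)) (m - i).
rewrite (@tmap_comp _ _ _ _ _ _ _ _ _ _ _ F G) //.
rewrite (@tmap_comp _ _ _ _ _ _ _ _ _ _ _ F G) //; last first.
  by move=> y; apply: same_degree_diff; rewrite opprD addrA subrK.
by rewrite sign_int_succ scaleNr subrr.
Qed.

Definition tensc : complex := Complex tensc_shape tensc_sq.
End TensorComplex.

Section Homology.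
Variables (X : complex) (i : int).

Definition cycle_pred (x : X i) : bool := cdiff X i (i - 1) x == 0.
Lemma cycle_closed : submod_closed cycle_pred.
Proof.
split=> [|a x y]; first by rewrite unfold_in /cycle_pred linear0.
rewrite !unfold_in /cycle_pred => /eqP x0 /eqP y0.
by rewrite linearP x0 y0 scaler0 addr0.
Qed.
HB.instance Definition _ := GRing.isSubmodClosed.Build A (X i) cycle_pred
  (GRing.submod_closed_semi cycle_closed).

Record cycles := Cycle { cycle_val :> X i; cycle_valP : cycle_pred cycle_val }.
HB.instance Definition _ := [isSub for cycle_val].
HB.instance Definition _ := [Choice of cycles by <:].
HB.instance Definition _ := [SubChoice_isSubLmodule of cycles by <:].

Definition boundary_pred (z : cycles) : bool :=
  `[< exists y : X (i + 1), cdiff X (i + 1) i y = cycle_val z >].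
Lemma boundary_closed : submod_closed boundary_pred.
Proof.
split=> [|a z t]; first by apply/asboolP; exists 0; rewrite linear0.
move=> /asboolP[y yz] /asboolP[u ut]; apply/asboolP; exists (a *: y + u).
by rewrite linearP yz ut.
Qed.

Definition homology : lmodType A := quotmod (Submodule boundary_closed).
End Homology.

(* [n] such that [V] is isomorphic to [A^n], if there is one (this [n] is unique
   as [A] is a nonzero commutative ring), and [0] otherwise *)
Definition dim (V : lmodType A) : nat :=
  xget 0%N [set n | exists f : {linear V -> 'rV[A]_n}, bijective f]%classic.

End Complexes.

Section ExtComplex.
Variables (A B : comNzRingType) (phi : {rmorphism A -> B}) (X : complex A).

Definition extc_diff i j : {linear ext_scalars phi (X i) -> ext_scalars phi (X j)} :=
  ext_map phi (cdiff X i j).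
Lemma extc_shape i j : i != j + 1 -> forall x, extc_diff i j x = 0.
Proof. by move=> ij; apply: tmap_eq0l; apply: cdiff_shape. Qed.
Lemma extc_sq i j k x : extc_diff j k (extc_diff i j x) = 0.
Proof. by apply: tmap_comp0l; apply: cdiff_sq. Qed.

Definition extc : complex B := Complex extc_shape extc_sq.
End ExtComplex.

Section Subcategories.
Variable (R : comNzRingType).

(* A full subcategory closed under isomorphism is given by its objects.  Closure
   under finite direct sums is automatic: [X (+) Y] is the cone of the zero map
   from the desuspension of [X] to [Y]. *)
Record triangulated_subcategory (C : complex R -> Prop) : Prop := {
  tri_perfect : forall X, C X -> perfect X;
  tri_iso : forall X Y, perfect Y -> homotopy_equivalent X Y -> C X -> C Y;
  tri_zero : forall X, perfect X -> zero_object X -> C X;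
  tri_shift : forall X, C (shift X) <-> C X;
  tri_cone : forall X Y (f : chain_map X Y), C X -> C Y -> C (cone f) }.

Record triangulated_ideal (C : complex R -> Prop) : Prop := {
  ideal_tri : triangulated_subcategory C;
  ideal_tens : forall X Y, C X -> perfect Y -> C (tensc X Y) }.

Variable p : prime_idealr R.

Definition residue_map : {rmorphism R -> {ideal_quot p}} := \pi_{ideal_quot p}.

(* [\sum_(i \in [set: int])] ranges over the finite support of the summand *)
Definition Lambda (X : complex R) : int :=
  \sum_(i \in [set: int]%classic)
    (-1) ^+ absz i * (dim (homology (extc residue_map X) i))%:Z.

(* For [m = 0] the congruence is an equality, since [(x %% 0)%Z = x].  The
   subcategory of zero objects is triangulated but is not of this form: every
   [Dcat p m] contains the direct sum of [R] and its suspension, which has zero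
   [Lambda] and is not a zero object. *)
Definition Dcat (m : nat) (X : complex R) : Prop :=
  perfect X /\ (Lambda X = 0 %[mod m%:Z])%Z.

End Subcategories.

(* Main.v *)
(** Let C contain a noncontractible X.  Killing homology from the bottom, one
    finds a cycle e of X and a functional q on X with q(e) = 1 and q o d valued
    in a finitely generated nil ideal J: so R is a summand of X modulo J.  If
    this holds modulo J and modulo J', for Z and for X, it holds modulo JJ' for
    the homotopy fibre product P of Z and X over their tensor product: the fibre
    of R -> P is the tensor product of the fibres of R -> Z and R -> X.  As J is
    nilpotent, R is a retract of some Z in C; tensoring with W, every
    perfect W is a retract of an object of C, whence W (+) W[1] is in C.  By
    devissage, each perfect complex becomes an object of C after adding a
    split complex of opposite Euler characteristic; hence membership in C
    depends on Lambda only, and the values of Lambda on C form a subgroup mZ.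

    Devissage means: attaching minimal sets of generators of the homology, from
    the bottom up, turns any perfect complex into a contractible one, because
    its last nonzero homology module is projective, hence free.  It also shows
    that C is an ideal. *)

Require Import Defs.
From mathcomp Require Import all_boot all_algebra ring_quotient.
From HB Require Import structures.
From mathcomp Require Import order generic_quotient zify boolp classical_sets cardinality fsbigop.

Set Implicit Arguments.
Unset Strict Implicit.
Unset Printing Implicit Defensive.

Import Order.TTheory GRing.Theory Num.Theory.

(** The ring need not be Noetherian: [p] may be infinitely generated and not nilpotent, although
    each of its elements is nilpotent. So [J] is generated by the values of [q o d] on finitely many
    generators of a single module, and only such an ideal is raised to powers. Moreover [C] is not
    assumed to be closed under summands, so that exhibiting [W] as a retract of [Z] in [C], by
    [i : W -> Z] and [q : Z -> W], does not put [W] in [C]. But the endomorphism [1 - iq] of [Z] is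
    zero on [W] and invertible on the complement, and its cone, which [C] contains, is [W (+) W[1]].
    The fibre product involves the tensor product of two objects of [C], so the ideal property has
    to be established before density. Exact triangles are handled as short exact sequences that
    split in each degree: tensoring with a complex keeps them so, ranks add up along them, and cones
    supply the rotations. *)

Local Notation sd V i j := (@same_degree _ V i j).

(** * Rings with a unique prime ideal *)

Section UniquePrime.
Local Open Scope ring_scope.

(** Krull's argument: an ideal that is maximal among those containing [I] and avoiding [S] is
    prime. *)
Lemma prime_avoiding (R : comNzRingType) (I S : R -> Prop) :
  I 0 -> (forall a x y, I x -> I y -> I (a * x + y)) ->
  S 1 -> (forall x y, S x -> S y -> S (x * y)) -> (forall x, I x -> ~ S x) ->
  exists q : prime_idealr R, forall x, (I x -> x \in q) /\ (x \in q -> ~ S x).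
Proof.
move=> I0 Icl S1 SM IS.
(* The last clause makes every nonempty [A] contain [I]. The empty set satisfies [P] as well,
   because Zorn's lemma also asks for the union of the empty chain; it is not maximal, since [I] is
   larger. *)
pose P (A : set R) := [/\ (forall a x y, A x -> A y -> A (a * x + y)),
  (forall x, A x -> ~ S x) & (forall x y, A x -> I y -> A y)].
have [F FP Ftot|A [[Acl AS AI] Amax]] := @Zorn_bigcup R P.
  split=> [a x y [X FX Xx] [Y FY Yy]|x [X FX Xx]|x y [X FX Xx] Iy].
  - have [XY|YX] := Ftot _ _ FX FY.
      by exists Y => //; have [h _ _] := FP _ FY; apply: h => //; apply: XY.
    by exists X => //; have [h _ _] := FP _ FX; apply: h => //; apply: YX.
  - by have [_ h _] := FP _ FX; apply: h.
  - by exists X => //; have [_ _ h] := FP _ FX; exact: h Xx Iy.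
have [a0 Aa0] : exists x, A x.
  apply: contrapT => An; apply: (Amax I).
    by split=> [x Ax|IA]; [case: An; exists x|apply: An; exists 0; apply: IA].
  by split.
have IA x : I x -> A x by move=> Ix; apply: AI Aa0 Ix.
(* Otherwise the ideal [R u + A] would be strictly larger than [A] and still avoid [S]. *)
have meet u : ~ A u -> exists r a, A a /\ S (r * u + a).
  move=> Au; apply: contrapT => H.
  apply: (Amax (fun x => exists r a, A a /\ x = r * u + a)).
    split; first by move=> x Ax; exists 0, x; rewrite mul0r add0r.
    apply/existsNP; exists u => h; apply: Au; apply: h; exists 1, 0.
    by rewrite mul1r addr0; split=> //; apply: IA.
  split=> [a x y [r [b [Ab ->]]] [s [c [Ac ->]]]|x [r [b [Ab ->]]] Sx|x y _ Iy].
  - exists (a * r + s), (a * b + c); split; first exact: Acl.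
    by rewrite mulrDr mulrDl mulrA addrACA.
  - by apply: H; exists r, b.
  - by exists 0, y; rewrite mul0r add0r; split=> //; apply: IA.
pose q x := `[< A x >].
have qid : idealr_closed q.
  split; first by apply/asboolP; apply: IA.
    by apply/negP => /asboolP /AS.
  by move=> a x y /asboolP Ax /asboolP Ay; apply/asboolP; apply: Acl.
have qpr : prime_idealr_closed q.
  move=> u v /asboolP Auv; apply: contrapT => /negP; rewrite negb_or.
  move=> /andP[/asboolP/meet[r [a [Aa Sa]]] /asboolP/meet[s [b [Ab Sb]]]].
  apply: (AS ((r * u + a) * (s * v + b))); last exact: SM.
  have A0 : A 0 by apply: IA.
  have AM c x : A x -> A (c * x) by move=> Ax; rewrite -[_ * x]addr0; apply: Acl.
  have AD x y : A x -> A y -> A (x + y).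
    by move=> Ax Ay; rewrite -[x]mul1r; apply: Acl.
  rewrite mulrDl [(r * u) * _]mulrDr.
  have -> : r * u * (s * v) = (r * s) * (u * v) by rewrite mulrACA.
  by do 2?[apply/AD]; [apply/AM|apply/AM|rewrite mulrC; apply/AM].
pose q' : prime_idealr R := HB.pack (q : R -> bool) (isIdealr.Build R q qid)
   (isPrimeIdealrClosed.Build R q qpr).
exists q' => x; split; first by move=> Ix; apply/asboolP; apply: IA.
by move=> /asboolP /AS.
Qed.

Variables (R : comNzRingType) (p : prime_idealr R).
Hypothesis p_unique : forall q : prime_idealr R, q =i p.

(** If no power of [x] vanished, some prime ideal would avoid them all; it would be [p], which
    contains [x]. *)
Lemma prime_nilpotent x : x \in p -> exists n, x ^+ n = 0.
Proof.
move=> xp; apply: contrapT => xn.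
have [|||||q qP] := @prime_avoiding R (eq^~ 0) (fun y => exists n, y = x ^+ n) => //.
- by move=> a y z -> ->; rewrite mulr0 addr0.
- by exists 0%N.
- by move=> y z [m ->] [n ->]; exists (m + n)%N; rewrite exprD.
- by move=> y -> [n xn0]; apply: xn; exists n.
have [_] := qP x; apply; first by rewrite p_unique.
by exists 1%N.
Qed.

(** If [R x] did not contain [1], it would lie in a prime ideal, that is in [p]. *)
Lemma notin_prime_unit x : x \notin p -> exists y, y * x = 1.
Proof.
move=> xp; apply: contrapT => xn.
have [|||||q qP] := @prime_avoiding R (fun y => exists a, y = a * x) (eq^~ 1) => //.
- by exists 0; rewrite mul0r.
- by move=> a y z [b ->] [c ->]; exists (a * b + c); rewrite mulrDl mulrA.
- by move=> y z -> ->; rewrite mulr1.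
- by move=> y [a ->] ax; apply: xn; exists a.
have [+ _] := qP x; rewrite p_unique => h; move/negP: xp; apply; apply: h.
by exists 1; rewrite mul1r.
Qed.
End UniquePrime.

(** * Finitely generated projective modules through dual bases *)

Section DualBases.
Local Open Scope ring_scope.
Variable A : comNzRingType.

(** By the dual basis lemma this is finite generation and projectivity at once, in a form that
    passes to sums and tensor products without solving lifting problems. *)
Definition has_dual_basis (M : lmodType A) : Prop :=
  exists s : seq (M * {linear M -> A^o}), forall x, x = \sum_(b <- s) b.2 x *: b.1.

Lemma scale_linear (M N : lmodType A) (f : {linear M -> A^o}) (y : N) :
  linear (fun x => f x *: y).
Proof. by move=> a x x'; rewrite linearP scalerDl scalerA. Qed.

Lemma sum_linear (I : Type) (s : seq I) (M N : lmodType A)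
  (f : I -> {linear M -> N}) : linear (fun x => \sum_(i <- s) f i x).
Proof.
move=> a x y; rewrite scaler_sumr -big_split; apply: eq_bigr => i _.
by rewrite linearP.
Qed.

Lemma comp_linear (L M N : lmodType A) (g : {linear M -> N}) (f : {linear L -> M}) :
  linear (fun x => g (f x)).
Proof. by move=> a x y; rewrite !linearP. Qed.
Definition compl (L M N : lmodType A) (g : {linear M -> N}) (f : {linear L -> M}) :
  {linear L -> N} := mk_linear (comp_linear g f).

Lemma dual_basis_fg (M : lmodType A) : has_dual_basis M -> finitely_generated M.
Proof.
case=> s sP; exists (size s), (fun i => (tnth (in_tuple s) i).1) => x.
by exists (fun i => (tnth (in_tuple s) i).2 x); rewrite {1}(sP x) big_tnth.
Qed.

Lemma dual_basis_projective (M : lmodType A) : has_dual_basis M -> projective M.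
Proof.
case=> s sP X Y e f esurj.
have [c cP] := choice esurj.
exists (mk_linear (sum_linear s (fun b => mk_linear (scale_linear b.2 (c (f b.1)))))).
move=> x /=; rewrite linear_sum [in RHS](sP x) linear_sum.
by apply: eq_bigr => b _ /=; rewrite !linearZ cP.
Qed.

Lemma coord_linear m (j : 'I_m) : linear (fun v : 'rV[A]_m => v 0 j : A^o).
Proof. by move=> a x y; rewrite !mxE. Qed.
Definition coord m (j : 'I_m) : {linear 'rV[A]_m -> A^o} := mk_linear (coord_linear j).

Lemma rowcomb_linear m (M : lmodType A) (g : 'I_m -> M) :
  linear (fun v : 'rV[A]_m => \sum_i v 0 i *: g i).
Proof.
move=> a x y; rewrite scaler_sumr -big_split; apply: eq_bigr => i _ /=.
by rewrite !mxE scalerDl scalerA.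
Qed.
Definition rowcomb m (M : lmodType A) (g : 'I_m -> M) : {linear 'rV[A]_m -> M} :=
  mk_linear (rowcomb_linear g).

Lemma projective_dual_basis (M : lmodType A) :
  finitely_generated M -> projective M -> has_dual_basis M.
Proof.
move=> [n [g gP]] Mpr.
have [|f fP] := Mpr _ _ (rowcomb g) (idfun : {linear M -> M}).
  by move=> x; have [a ->] := gP x; exists (\row_i a i); apply: eq_bigr => i _; rewrite mxE.
exists [seq (g i, compl (coord i) f) | i <- enum 'I_n] => x.
by rewrite big_map big_enum -[LHS]fP.
Qed.

Lemma row_dual_basis m : has_dual_basis 'rV[A]_m.
Proof.
exists [seq (delta_mx 0 j, coord j) | j <- enum 'I_m] => x.
by rewrite big_map big_enum /= {1}(row_sum_delta x).
Qed.

Lemma fst_linear (M N : lmodType A) : linear (fst : M * N -> M).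
Proof. by []. Qed.
Lemma snd_linear (M N : lmodType A) : linear (snd : M * N -> N).
Proof. by []. Qed.
Lemma inl_linear (M N : lmodType A) : linear (fun x : M => (x, 0) : M * N).
Proof. by move=> a x y; apply/pair_eqP/andP; split; rewrite /= ?scaler0 ?addr0. Qed.
Lemma inr_linear (M N : lmodType A) : linear (fun x : N => (0, x) : M * N).
Proof. by move=> a x y; apply/pair_eqP/andP; split; rewrite /= ?scaler0 ?addr0. Qed.

Lemma pair_linear (L M N : lmodType A) (f : {linear L -> M}) (g : {linear L -> N}) :
  linear (fun x => (f x, g x)).
Proof. by move=> a x y; rewrite !linearP. Qed.
Definition pairl (L M N : lmodType A) (f : {linear L -> M}) (g : {linear L -> N}) :
  {linear L -> (M * N)%type} := mk_linear (pair_linear f g).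
Definition fstl (M N : lmodType A) : {linear (M * N)%type -> M} := mk_linear (@fst_linear M N).
Definition sndl (M N : lmodType A) : {linear (M * N)%type -> N} := mk_linear (@snd_linear M N).
Definition inll (M N : lmodType A) : {linear M -> (M * N)%type} := mk_linear (@inl_linear M N).
Definition inrl (M N : lmodType A) : {linear N -> (M * N)%type} := mk_linear (@inr_linear M N).

(** The hypothesis exhibits [N] as a retract of the finite sum of the [M k]; dual bases are pushed
    forward by [i] and pulled back by [r]. *)
Lemma sum_dual_basis (I : eqType) (s : seq I) (N : lmodType A) (M : I -> lmodType A)
    (i : forall k, {linear M k -> N}) (r : forall k, {linear N -> M k}) :
  (forall x, x = \sum_(k <- s) i k (r k x)) ->
  (forall k, has_dual_basis (M k)) -> has_dual_basis N.
Proof.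
move=> irP Mdb; pose b k := sval (cid (Mdb k)).
have bP k := svalP (cid (Mdb k)); rewrite -/(b _) in bP.
exists (flatten [seq [seq (i k c.1, compl c.2 (r k)) | c <- b k] | k <- s]) => x.
rewrite big_flatten big_map {1}(irP x); apply: eq_bigr => k _.
rewrite big_map {1}(bP k (r k x)) linear_sum.
by apply: eq_bigr => c _; rewrite linearZ.
Qed.

Lemma pair_dual_basis (M N : lmodType A) :
  has_dual_basis M -> has_dual_basis N -> has_dual_basis (M * N)%type.
Proof.
move=> [s sP] [t tP].
exists ([seq ((b.1, 0), compl b.2 (@fstl M N)) | b <- s] ++
        [seq ((0, b.1), compl b.2 (@sndl M N)) | b <- t]) => -[x y].
rewrite big_cat !big_map /=.
transitivity (@inll M N x + @inrl M N y).
  by apply/pair_eqP/andP; split; rewrite /= ?addr0 ?add0r.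
congr (_ + _).
  by rewrite {1}(sP x) linear_sum; apply: eq_bigr => b _; rewrite linearZ.
by rewrite {1}(tP y) linear_sum; apply: eq_bigr => b _; rewrite linearZ.
Qed.

(** The elements satisfying [P] form a submodule, and the quotient map by it vanishes on pure
    tensors, hence everywhere. *)
Lemma tens_ind (M N : lmodType A) (P : tens M N -> Prop) :
  P 0 -> (forall a x y, P x -> P y -> P (a *: x + y)) ->
  (forall m n, P (tpure m n)) -> forall z, P z.
Proof.
move=> P0 PD Pt.
have Pcl : submod_closed (fun z => `[< P z >]).
  split; first exact/asboolP.
  by move=> a x y /asboolP Px /asboolP Py; apply/asboolP; apply: PD.
move=> z; apply/asboolP.
change (z \in smem (Submodule Pcl)).
rewrite -[z]subr0 -qclass_eq raddf0; apply/eqP.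
apply: (@tens_ext _ _ _ _ (qclass (Submodule Pcl)) \0) => m n /=.
by apply/eqP; rewrite -(raddf0 (qclass (Submodule Pcl))) qclass_eq subr0; apply/asboolP.
Qed.

Lemma tens_dual_basis (M N : lmodType A) :
  has_dual_basis M -> has_dual_basis N -> has_dual_basis (tens M N).
Proof.
move=> [s sP] [t tP].
have bl (f : {linear M -> A^o}) (g : {linear N -> A^o}) n :
    linear (fun m => f m * g n : A^o).
  by move=> a x y; rewrite linearP mulrDl -scalerAl.
have br (f : {linear M -> A^o}) (g : {linear N -> A^o}) m :
    linear (fun n => f m * g n : A^o).
  by move=> a x y; rewrite linearP mulrDr -scalerAr.
pose F (b : M * {linear M -> A^o}) (c : N * {linear N -> A^o}) :
  {linear tens M N -> A^o} := tlift (bl b.2 c.2) (br b.2 c.2).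
exists [seq (tpure b.1 c.1, F b c) | b <- s, c <- t].
pose G := sum_linear [seq (tpure b.1 c.1, F b c) | b <- s, c <- t]
   (fun b => mk_linear (scale_linear b.2 b.1)).
apply: (@tens_ext _ _ _ _ idfun (mk_linear G)) => m n /=.
have tl y : linear ((@tpure A M N)^~ y) by move=> a u v; apply: tpureDl.
have tr y : linear (@tpure A M N y) by move=> a u v; apply: tpureDr.
have sumE : tpure m n = \sum_(b <- s) \sum_(c <- t) (b.2 m * c.2 n) *: tpure b.1 c.1.
  have -> : tpure m n = mk_linear (tl n) m by [].
  rewrite [in LHS](sP m) linear_sum; apply: eq_bigr => b _; rewrite linearZ /=.
  have -> : tpure b.1 n = mk_linear (tr b.1) n by [].
  rewrite [in LHS](tP n) linear_sum scaler_sumr; apply: eq_bigr => c _.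
  by rewrite linearZ scalerA.
rewrite big_allpairs_dep [LHS]sumE; apply: eq_bigr => b _; apply: eq_bigr => c _ /=.
by rewrite tliftE.
Qed.

Definition int_range (n : nat) : seq int := [seq k%:Z - n%:Z | k <- iota 0 (2 * n).+1].

Lemma mem_int_range n i : (i \in int_range n) = (absz i <= n)%N.
Proof.
apply/mapP/idP => [[k]|le_in].
  rewrite mem_iota /= add0n ltnS => kn ->; lia.
exists (absz (i + n%:Z)); last by lia.
by rewrite mem_iota; lia.
Qed.

Lemma int_range_uniq n : uniq (int_range n).
Proof. by rewrite map_inj_uniq ?iota_uniq // => i j; lia. Qed.

Lemma dsum_in_subproof (V : int -> lmodType A) i (x : V i) :
  finite_set [set j | sd V i j x != 0]%classic.
Proof.
apply: (@sub_finite_set _ _ [set i]%classic); last exact: finite_set1.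
by move=> j /=; apply: contra_neqP => /eqP ij; rewrite same_degree0 // eq_sym.
Qed.

Definition dsum_in_fun (V : int -> lmodType A) i (x : V i) : dsum V :=
  DSum (dsum_in_subproof x).
Lemma dsum_in_linear (V : int -> lmodType A) i : linear (@dsum_in_fun V i).
Proof. by move=> a x y; apply: dsumP => j /=; rewrite linearP. Qed.
Definition dsum_in (V : int -> lmodType A) i : {linear V i -> dsum V} := mk_linear (@dsum_in_linear V i).

Lemma dval_linear (V : int -> lmodType A) i : linear (fun z : dsum V => dval z i).
Proof. by []. Qed.
Definition dproj (V : int -> lmodType A) i : {linear dsum V -> V i} :=
  mk_linear (@dval_linear V i).

Lemma dsum_dual_basis (V : int -> lmodType A) n :
  (forall i, (n < absz i)%N -> forall x : V i, x = 0) ->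
  (forall i, has_dual_basis (V i)) -> has_dual_basis (dsum V).
Proof.
move=> V0; apply: (sum_dual_basis (s := int_range n) (i := dsum_in V) (r := dproj V)).
move=> z; apply: dsumP => j.
rewrite -[RHS]/(dproj V j _) linear_sum /=.
have [jn|jn] := boolP (j \in int_range n).
  rewrite (bigD1_seq j) ?int_range_uniq //= same_degreeE big1 ?addr0 // => i ij.
  by rewrite same_degree0.
rewrite big1_seq => [|i /andP[_ iin]]; first by apply: V0; rewrite mem_int_range -ltnNge in jn.
by rewrite same_degree0 //; apply: contraNneq jn => <-.
Qed.
End DualBases.

(** * Transport between equal degrees *)

Section Degrees.
Local Open Scope ring_scope.
Variable A : comNzRingType.
Implicit Types V W : int -> lmodType A.

Definition sdl V i j : {linear V i -> V j} := @same_degree A V i j.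

(** The hypothesis rules out a detour from [i] to [i] through another degree [j], which sends [x] to
    [0]. *)
Lemma sd_comp V i j k (x : V i) : (i == j) || (j == k) ->
  sd V j k (sd V i j x) = sd V i k x.
Proof. by case/orP => /eqP e; subst j; rewrite same_degreeE. Qed.

Lemma sd_nat V W (F : forall i, {linear V i -> W i}) i j (x : V i) :
  F j (sd V i j x) = sd W i j (F i x).
Proof.
have [e|ij] := eqVneq i j; first by subst j; rewrite !same_degreeE.
by rewrite !same_degree0 // linear0.
Qed.

End Degrees.

(** * Homotopies, cones and degreewise split exact sequences *)

Section Homotopies.
Local Open Scope ring_scope.
Variable A : comNzRingType.
Implicit Types X Y Z : complex A.

Lemma perfectP X : perfect X <-> bounded X /\ forall i, has_dual_basis (X i).
Proof.
split=> -[bX Xi]; split=> // i; first by have [] := Xi i; apply: projective_dual_basis.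
by split; [apply: dual_basis_fg | apply: dual_basis_projective].
Qed.

Lemma homotopy_equivalent_sym X Y : homotopy_equivalent X Y -> homotopy_equivalent Y X.
Proof. by move=> [f [g [h1 h2]]]; exists g, f. Qed.

Lemma homotopic_eq X Y (f g : chain_map X Y) :
  (forall i x, f i x = g i x) -> homotopic f g.
Proof. by move=> fg; exists (fun i j => \0) => i x; rewrite fg subrr linear0 addr0. Qed.

Lemma iso_homotopy_equivalent X Y (f : chain_map X Y) (g : chain_map Y X) :
  (forall i x, g i (f i x) = x) -> (forall i x, f i (g i x) = x) ->
  homotopy_equivalent X Y.
Proof. by move=> gf fg; exists f, g; split; apply: homotopic_eq. Qed.

(** The neighbouring degrees become variables constrained by equations, so that they can be given by
    whichever expression occurs, without transport. *)
Lemma zero_objectP X : zero_object X <->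
  exists h : forall i j, {linear X i -> X j}, forall i j k, j = i + 1 -> i = k + 1 ->
    forall x, x = cdiff X j i (h i j x) + h k i (cdiff X i k x).
Proof.
split=> -[h hP]; exists h.
  move=> i j k -> e x; have {e} -> : k = i - 1 by rewrite e addrK.
  by rewrite -hP /= subr0.
by move=> i x; rewrite -(hP _ _ _ erefl) ?subrK //= subr0.
Qed.

Lemma trivial_zero_object X : (forall i (x : X i), x = 0) -> zero_object X.
Proof. by move=> X0; apply: homotopic_eq => i x; rewrite (X0 _ x) linear0. Qed.

Lemma bounded_cone X Y (f : chain_map X Y) : bounded X -> bounded Y -> bounded (cone f).
Proof.
move=> [m Xm] [n Yn]; exists (m + n).+1 => i lt_i [x y].
by apply/pair_eqP/andP; split; apply/eqP; [apply: Xm|apply: Yn]; lia.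
Qed.

Lemma perfect_cone X Y (f : chain_map X Y) : perfect X -> perfect Y -> perfect (cone f).
Proof.
move=> /perfectP[bX Xi] /perfectP[bY Yi]; apply/perfectP; split.
  exact: bounded_cone.
by move=> i; apply: pair_dual_basis.
Qed.

Lemma perfect_shift X : perfect X -> perfect (shift X).
Proof.
move=> /perfectP[[n Xn] Xi]; apply/perfectP; split; last by move=> i; apply: Xi.
by exists n.+1 => i lt_i x; apply: Xn; lia.
Qed.

(** The splittings [se_r] and [se_s] are only graded: they need not commute with the differentials.
    Such sequences stand for exact triangles. *)
Record split_exact X Y Z := SplitExact {
  se_i : chain_map X Y;
  se_p : chain_map Y Z;
  se_r : forall n, {linear Y n -> X n};
  se_s : forall n, {linear Z n -> Y n};
  se_ri : forall n x, se_r n (se_i n x) = x;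
  se_ps : forall n z, se_p n (se_s n z) = z;
  se_id : forall n y, se_i n (se_r n y) + se_s n (se_p n y) = y }.

Section SplitExactCone.
Variables (X Y Z : complex A) (E : split_exact X Y Z).
Local Notation i := (se_i E).
Local Notation p := (se_p E).
Local Notation r := (se_r E).
Local Notation s := (se_s E).

Lemma se_inj n x x' : i n x = i n x' -> x = x'.
Proof. by move=> e; rewrite -[x](se_ri E) e se_ri. Qed.

Lemma se_pi n x : p n (i n x) = 0.
Proof.
have := se_id E (i n x); rewrite se_ri => /(congr1 (p n)).
by rewrite linearD se_ps => /eqP; rewrite -subr_eq0 addrK => /eqP.
Qed.

(** This measures how far [se_s] is from being a chain map; up to sign it represents the boundary
    morphism from [Z] to the suspension of [X]. *)
Definition connecting n m : {linear Z n -> X m} :=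
  compl (r m) (compl (cdiff Y n m) (s n)).

Lemma connectingE n m z : i m (connecting n m z) = cdiff Y n m (s n z) - s m (cdiff Z n m z).
Proof.
have := se_id E (cdiff Y n m (s n z)); rewrite /= cmap_diff se_ps => e.
by rewrite -[in RHS]e addrK.
Qed.

Lemma connecting_diff n m k z :
  cdiff X m k (connecting n m z) = - connecting m k (cdiff Z n m z).
Proof.
apply: se_inj; rewrite cmap_diff connectingE linearB cdiff_sq sub0r linearN connectingE.
by rewrite cdiff_sq linear0 subr0.
Qed.

Lemma se_rd n m y :
  r m (cdiff Y n m y) = cdiff X n m (r n y) + connecting n m (p n y).
Proof.
by rewrite -{1}(se_id E y) linearD -cmap_diff linearD se_ri.
Qed.

Definition cone_proj_fun n : {linear cone i n -> Z n} := compl (p n) (@sndl A _ _).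
Lemma cone_proj_comm n m z :
  cone_proj_fun m (cdiff (cone i) n m z) = cdiff Z n m (cone_proj_fun n z).
Proof. by rewrite /= linearD sd_nat se_pi linear0 add0r cmap_diff. Qed.
Definition cone_proj : chain_map (cone i) Z := ChainMap cone_proj_comm.

(** The failure of [se_s] to commute with the differentials is compensated in the summand
    [X (n - 1)] of the cone. *)
Definition cone_sec_fun n : {linear Z n -> cone i n} :=
  pairl (\- connecting n (n - 1)) (s n).
Lemma cone_sec_comm n m z :
  cone_sec_fun m (cdiff Z n m z) = cdiff (cone i) n m (cone_sec_fun n z).
Proof.
have [e|nm] := eqVneq n (m + 1); last by rewrite !cdiff_shape // linear0.
have {e} -> : m = n - 1 by rewrite e addrK.
rewrite /= /cone_diff_fun; apply/pair_eqP/andP; split=> /=.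
  by rewrite !linearN opprK -[X in _ == X]/(cdiff X _ _ (connecting _ _ _)) connecting_diff.
rewrite linearN same_degreeE -/(compl _ _ _) -[r _ _]/(connecting n (n - 1) z) connectingE.
by rewrite opprB subrK.
Qed.
Definition cone_sec : chain_map Z (cone i) := ChainMap cone_sec_comm.

(** Up to sign, [se_r] read as a map of degree one from the summand [Y] to the summand [X]. It
    contracts the kernel of [cone_proj], a copy of the cone of the identity of [X]. *)
Definition cone_htpy n m : {linear cone i n -> cone i m} :=
  pairl (\- compl (sdl X n (m - 1)) (compl (r n) (@sndl A _ _))) \0.

Lemma split_exact_cone : homotopy_equivalent (cone i) Z.
Proof.
exists cone_proj, cone_sec; split; last first.
  by apply: homotopic_eq => n z /=; rewrite se_ps.
exists cone_htpy => n [x y]; apply/pair_eqP/andP; split=> /=; apply/eqP.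
  rewrite same_degreeE [sdl _ _ _ _]/= [sdl _ _ _ _]/=.
  rewrite linearN opprK (@same_degree_diff _ X _ _ (n - 1)) ?same_degreeE; last by rewrite addrK subrK.
  by rewrite linearD se_ri [in RHS]se_rd /= (addrC x) opprD addrA opprD addrA subrr sub0r.
rewrite [in RHS]linear0 !addr0 2!linearN (@sd_nat _ X Y i) /= sd_comp ?addrK ?eqxx //.
by rewrite same_degreeE -{2}(se_id E y) opprD addrCA subrr addr0.
Qed.
End SplitExactCone.

Section ConeExact.
Variables (X Y : complex A) (f : chain_map X Y).

Lemma cone_incl_comm n m y :
  inrl (X (m - 1)) (Y m) (cdiff Y n m y) = cdiff (cone f) n m (inrl (X (n - 1)) (Y n) y).
Proof. by apply/pair_eqP/andP; split; rewrite /= ?linear0 ?oppr0 ?add0r. Qed.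
Definition cone_incl : chain_map Y (cone f) :=
  @ChainMap _ Y (cone f) (fun n => inrl (X (n - 1)) (Y n)) cone_incl_comm.

Lemma cone_quot_comm n m z :
  fstl (X (m - 1)) (Y m) (cdiff (cone f) n m z)
  = cdiff (shift X) n m (fstl (X (n - 1)) (Y n) z).
Proof. by []. Qed.
Definition cone_quot : chain_map (cone f) (shift X) :=
  @ChainMap _ (cone f) (shift X) (fun n => fstl (X (n - 1)) (Y n)) cone_quot_comm.

Lemma cone_split_exact : split_exact Y (cone f) (shift X).
Proof.
exists cone_incl cone_quot (fun n => sndl (X (n - 1)) (Y n))
  (fun n => inll (X (n - 1)) (Y n)) => // n [x y].
by apply/pair_eqP/andP; split; rewrite /= ?add0r ?addr0.
Qed.
End ConeExact.

Lemma cone_id_zero X : zero_object (cone (idc X)).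
Proof.
apply/zero_objectP; exists (fun n m => pairl (compl (sdl X n (m - 1)) (@sndl A _ _)) \0).
move=> n _ m -> -> [x y]; apply/pair_eqP/andP; split=> /=; apply/eqP.
  rewrite (@same_degree_diff _ X _ _ m); last by rewrite addrK.
  rewrite linearD /= [RHS]addrC [RHS]addrK sd_comp; last by rewrite addrK eqxx orbT.
  by rewrite same_degreeE.
by rewrite linear0 !addr0 sd_comp ?same_degreeE // addrK eqxx.
Qed.

End Homotopies.

(** * Split complexes, products, changes of degree and retracts *)

Section SplitComplexes.
Local Open Scope ring_scope.
Variable A : comNzRingType.

Lemma splitc_shape (f : int -> nat) i j : i != j + 1 ->
  forall x : 'rV[A]_(f i), (\0 : 'rV[A]_(f i) -> 'rV[A]_(f j)) x = 0.
Proof. by []. Qed.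
Lemma splitc_sq (f : int -> nat) i j k (x : 'rV[A]_(f i)) :
  (\0 : 'rV[A]_(f j) -> 'rV[A]_(f k)) ((\0 : 'rV[A]_(f i) -> 'rV[A]_(f j)) x) = 0.
Proof. by []. Qed.
Definition splitc (f : int -> nat) : complex A :=
  @Complex A (fun i => 'rV[A]_(f i)) (fun i j => \0) (@splitc_shape f) (@splitc_sq f).

Definition fin_supp (f : int -> nat) : Prop :=
  exists n : nat, forall i, (n < absz i)%N -> f i = 0%N.

Lemma fin_suppD f g : fin_supp f -> fin_supp g -> fin_supp (fun i => f i + g i)%N.
Proof. by move=> [m fm] [n gn]; exists (m + n)%N => i lt_i; rewrite fm ?gn //; lia. Qed.

Lemma fin_supp_shift f s : fin_supp f -> fin_supp (fun i => f (i + s)).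
Proof. by move=> [m fm]; exists (m + absz s)%N => i lt_i; apply: fm; lia. Qed.

Lemma fin_supp_delta r s : fin_supp (fun i => r * (i == s))%N.
Proof.
by exists (absz s) => i; case: eqVneq => [->|_ _]; rewrite ?ltnn ?muln0.
Qed.

Lemma rV_trivial n (x : 'rV[A]_n) : n = 0%N -> x = 0.
Proof. by move=> n0; apply/rowP => -[j jn]; exfalso; rewrite n0 in jn. Qed.

Lemma perfect_splitc f : fin_supp f -> perfect (splitc f).
Proof.
move=> [n fn]; apply/perfectP; split; last by move=> i; apply: row_dual_basis.
by exists n => i lt_i x; apply: rV_trivial; apply: fn.
Qed.

Lemma splitc_exact f g : split_exact (splitc f) (splitc (fun i => f i + g i)%N) (splitc g).
Proof.
have il i : linear (fun x : 'rV[A]_(f i) => row_mx x (0 : 'rV[A]_(g i))).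
  by move=> a x y; rewrite scale_row_mx add_row_mx scaler0 addr0.
have sl i : linear (fun x : 'rV[A]_(g i) => row_mx (0 : 'rV[A]_(f i)) x).
  by move=> a x y; rewrite scale_row_mx add_row_mx scaler0 addr0.
have rl i : linear (fun x : 'rV[A]_(f i + g i) => lsubmx x).
  by move=> a x y; rewrite linearP.
have pl i : linear (fun x : 'rV[A]_(f i + g i) => rsubmx x).
  by move=> a x y; rewrite linearP.
have ic i j x : mk_linear (il j) (cdiff (splitc f) i j x) =
    cdiff (splitc (fun i => f i + g i)%N) i j (mk_linear (il i) x) by rewrite linear0.
have pc i j x : mk_linear (pl j) (cdiff (splitc (fun i => f i + g i)%N) i j x) =
    cdiff (splitc g) i j (mk_linear (pl i) x) by rewrite linear0.
exists (@ChainMap _ (splitc f) (splitc (fun i => f i + g i)%N) _ ic)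
  (@ChainMap _ (splitc (fun i => f i + g i)%N) (splitc g) _ pc)
  (fun i => mk_linear (rl i)) (fun i => mk_linear (sl i)) => n x /=.
- by rewrite row_mxKl.
- by rewrite row_mxKr.
- by rewrite add_row_mx addr0 add0r hsubmxK.
Qed.

Section Product.
Variables X Y : complex A.
Let V i : lmodType A := (X i * Y i)%type.
Definition prodc_diff i j : {linear V i -> V j} :=
  pairl (compl (cdiff X i j) (@fstl A _ _)) (compl (cdiff Y i j) (@sndl A _ _)).
Lemma prodc_shape i j : i != j + 1 -> forall x, prodc_diff i j x = 0.
Proof. by move=> ij x; rewrite /= !cdiff_shape. Qed.
Lemma prodc_sq i j k x : prodc_diff j k (prodc_diff i j x) = 0.
Proof. by rewrite /= !cdiff_sq. Qed.
Definition prodc : complex A := Complex prodc_shape prodc_sq.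

Lemma perfect_prodc : perfect X -> perfect Y -> perfect prodc.
Proof.
move=> /perfectP[[m Xm] Xi] /perfectP[[n Yn] Yi]; apply/perfectP; split.
  exists (m + n)%N => i lt_i [x y].
  by apply/pair_eqP/andP; split; apply/eqP; [apply: Xm|apply: Yn]; lia.
by move=> i; apply: pair_dual_basis.
Qed.

Lemma prodc_exact : split_exact X prodc Y.
Proof.
have ic i j x : inll (X j) (Y j) (cdiff X i j x) = cdiff prodc i j (inll (X i) (Y i) x).
  by rewrite /= linear0.
exists (@ChainMap _ X prodc (fun i => inll (X i) (Y i)) ic)
  (@ChainMap _ prodc Y (fun i => sndl (X i) (Y i)) (fun i j z => erefl))
  (fun i => fstl (X i) (Y i)) (fun i => inrl (X i) (Y i)) => // i [x y].
by apply/pair_eqP/andP; split; rewrite /= ?addr0 ?add0r.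
Qed.
End Product.

Section Reindexing.
Variables (X : complex A) (s : int -> int).
Hypothesis sP : forall i j, i != j + 1 -> s i != s j + 1.

Lemma reindex_shape i j : i != j + 1 -> forall x, cdiff X (s i) (s j) x = 0.
Proof. by move=> /sP; apply: cdiff_shape. Qed.
Lemma reindex_sq i j k x : cdiff X (s j) (s k) (cdiff X (s i) (s j) x) = 0.
Proof. exact: cdiff_sq. Qed.
Definition reindex : complex A :=
  @Complex A (fun i => X (s i)) (fun i j => cdiff X (s i) (s j)) reindex_shape reindex_sq.
End Reindexing.

(** Equal index functions give equal complexes, not merely isomorphic ones, so that iterated delays
    can be combined by rewriting. *)
Lemma reindex_eq X s sP t tP : s = t -> @reindex X s sP = @reindex X t tP.
Proof. by move=> e; subst t; congr reindex; apply: Prop_irrelevance. Qed.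

Lemma complex_eq (V : int -> lmodType A) (d : forall i j, {linear V i -> V j})
    (sh1 sh2 : forall i j, i != j + 1 -> forall x, d i j x = 0)
    (sq1 sq2 : forall i j k x, d j k (d i j x) = 0) :
  @Complex A V d sh1 sq1 = @Complex A V d sh2 sq2.
Proof. by congr Complex; apply: Prop_irrelevance. Qed.

Lemma reindex_id X s sP : (forall i, s i = i) -> @reindex X s sP = X.
Proof.
move=> /funext e; rewrite (@reindex_eq X s sP id (fun i j ij => ij)) //.
by case: X => V d sh sq; apply: complex_eq.
Qed.

Lemma addr_shape (k : int) i j : i != j + 1 -> i + k != j + k + 1.
Proof. by rewrite addrAC (inj_eq (addIr _)). Qed.

(* [delay k X] is the [k]-fold desuspension of [X], without the sign change of
   the differential. *)
Definition delay k X := @reindex X (fun i => i + k) (@addr_shape k).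

Lemma delay_delay k l X : delay k (delay l X) = delay (k + l) X.
Proof.
have sP i j : i != j + 1 -> i + k + l != j + k + l + 1.
  by move=> ij; do 2!apply: addr_shape.
transitivity (reindex X sP); first exact: complex_eq.
by apply: reindex_eq; apply: funext => i; rewrite addrA.
Qed.

Lemma delay0 X : delay 0 X = X.
Proof. by apply: reindex_id => i; rewrite addr0. Qed.

Lemma perfect_delay k X : perfect X -> perfect (delay k X).
Proof.
move=> /perfectP[[n Xn] Xi]; apply/perfectP; split; last by move=> i; apply: Xi.
by exists (n + absz k)%N => i lt_i x; apply: Xn; lia.
Qed.

(** Scaling degree [i] by [(-1)^i] turns the differential [d] into [- d]. *)
Lemma delay_shift X : homotopy_equivalent (delay (- 1) X) (shift X).
Proof.
have sl i : linear (fun x : X (i - 1) => (-1) ^+ absz i *: x).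
  by move=> a x y; rewrite scalerDr !scalerA mulrC.
have e i j x : (-1) ^+ absz j *: cdiff X (i - 1) (j - 1) x
    = - cdiff X (i - 1) (j - 1) ((-1) ^+ absz i *: x).
  have [ei|ij] := eqVneq i (j + 1); last first.
    have ij' : i - 1 != j - 1 + 1 by rewrite addrAC (inj_eq (addIr _)).
    by rewrite !cdiff_shape // scaler0 oppr0.
  have -> : (-1) ^+ absz i = - (-1) ^+ absz j :> A by rewrite ei sign_int_succ.
  by rewrite linearZ /= scaleNr opprK.
have c1 i j x : mk_linear (sl j) (cdiff (delay (-1) X) i j x) =
   cdiff (shift X) i j (mk_linear (sl i) x) by apply: e.
have c2 i j x : mk_linear (sl j) (cdiff (shift X) i j x) =
   cdiff (delay (-1) X) i j (mk_linear (sl i) x) by rewrite /= scalerN e opprK.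
have sK i (x : X (i - 1)) : (-1) ^+ absz i *: ((-1) ^+ absz i *: x) = x.
  by rewrite scalerA -expr2 sqrr_sign scale1r.
exact: (@iso_homotopy_equivalent _ (delay (-1) X) (shift X)
  (@ChainMap _ (delay (-1) X) (shift X) _ c1) (@ChainMap _ (shift X) (delay (-1) X) _ c2)).
Qed.

Section Retract.
Variables (W Z : complex A) (i : chain_map W Z) (q : chain_map Z W).
Hypothesis qi : forall n x, q n (i n x) = x.

Lemma one_minus_comm n m z :
  (idfun \- (i m \o q m)) (cdiff Z n m z) = cdiff Z n m ((idfun \- (i n \o q n)) z).
Proof. by rewrite /= !cmap_diff linearB. Qed.
Definition one_minus : chain_map Z Z :=
  @ChainMap _ Z Z (fun n => idfun \- (i n \o q n)) one_minus_comm.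

(* Over the complement of [W] in [Z], the map [1 - iq] is invertible. *)
Lemma cone_one_minus : homotopy_equivalent (cone one_minus) (cone (zeroc W W)).
Proof.
pose F n : {linear cone one_minus n -> cone (zeroc W W) n} :=
  pairl (compl (q (n - 1)) (@fstl A _ _)) (compl (q n) (@sndl A _ _)).
pose G n : {linear cone (zeroc W W) n -> cone one_minus n} :=
  pairl (compl (i (n - 1)) (@fstl A _ _)) (compl (i n) (@sndl A _ _)).
have Fc n m z : F m (cdiff (cone one_minus) n m z) = cdiff (cone (zeroc W W)) n m (F n z).
  apply/pair_eqP/andP; split; rewrite /= ?linearN ?cmap_diff //.
  by rewrite linearD sd_nat linearB /= qi subrr !linear0 !add0r cmap_diff.
have Gc n m z : G m (cdiff (cone (zeroc W W)) n m z) = cdiff (cone one_minus) n m (G n z).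
  apply/pair_eqP/andP; split; rewrite /= ?linearN ?cmap_diff //.
  by rewrite qi subrr !linear0 !add0r cmap_diff.
exists (ChainMap Fc), (ChainMap Gc); split; last first.
  by apply: homotopic_eq => n [x y]; apply/pair_eqP/andP; split; rewrite /= qi.
exists (fun n m => pairl (\- compl (sdl Z n (m - 1)) (@sndl A _ _)) \0) => n [x y].
apply/pair_eqP/andP; split=> /=; apply/eqP.
  rewrite linearN opprK (@same_degree_diff _ Z _ _ (n - 1)) ?same_degreeE; last by rewrite addrK subrK.
  by rewrite opprD addrCA subrr addr0 opprB.
rewrite linear0 !addr0 !linearN opprK /= linearD linearN /= [RHS]addrC.
rewrite (@sd_nat _ Z W q n) (@sd_nat _ W Z i n) /=.
by rewrite !sd_comp ?addrK ?eqxx // !same_degreeE.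
Qed.
End Retract.
End SplitComplexes.

(** * Two out of three in a triangulated subcategory *)

Section Triangulated.
Local Open Scope ring_scope.
Variables (R : comNzRingType) (C : complex R -> Prop).
Hypothesis C_tri : triangulated_subcategory C.

Lemma tri_exactr X Y Z (E : split_exact X Y Z) : perfect Z -> C X -> C Y -> C Z.
Proof.
by move=> Zp CX CY; apply: (tri_iso C_tri Zp (split_exact_cone E)); apply: tri_cone.
Qed.

(** [Z] is equivalent to the cone of [se_i E], and the sequence formed by [Y], this cone and
    [shift X] puts [shift X] in [C]. *)
Lemma tri_exactl X Y Z (E : split_exact X Y Z) : perfect X -> C Y -> C Z -> C X.
Proof.
move=> Xp CY CZ; apply/(tri_shift C_tri).
apply: (tri_exactr (cone_split_exact (se_i E))) => //; first exact: perfect_shift.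
apply: (tri_iso C_tri) (homotopy_equivalent_sym (split_exact_cone E)) CZ.
by apply: perfect_cone => //; apply: tri_perfect CY.
Qed.

Lemma tri_exactm X Y Z (E : split_exact X Y Z) : perfect Y -> C X -> C Z -> C Y.
Proof.
move=> Yp CX CZ; apply: (tri_exactl (cone_split_exact (se_i E))) => //.
  apply: (tri_iso C_tri) (homotopy_equivalent_sym (split_exact_cone E)) CZ.
  by apply: perfect_cone => //; apply: tri_perfect CX.
exact/(tri_shift C_tri).
Qed.

Lemma tri_delayN1 X : C X -> C (delay (- 1) X).
Proof.
move=> CX; have Xp := tri_perfect C_tri CX.
apply: (tri_iso C_tri _ (homotopy_equivalent_sym (delay_shift X))).
  exact: perfect_delay.
exact/(tri_shift C_tri).
Qed.

Lemma tri_delay1 X : C X -> C (delay 1 X).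
Proof.
move=> CX; have Xp := tri_perfect C_tri CX.
apply/(tri_shift C_tri); apply: (tri_iso C_tri _ (delay_shift _)).
  by apply: perfect_shift; apply: perfect_delay.
by rewrite delay_delay addNr delay0.
Qed.

Lemma tri_delay k X : C X -> C (delay k X).
Proof.
move=> CX; elim: k => [|n IH|n IH]; first by rewrite delay0.
  by rewrite -addn1 PoszD addrC -delay_delay; apply: tri_delay1.
by rewrite -addn1 PoszD opprD addrC -delay_delay; apply: tri_delayN1.
Qed.

Lemma tri_retract W Z (i : chain_map W Z) (q : chain_map Z W) :
  (forall n x, q n (i n x) = x) -> perfect W -> C Z -> C (cone (zeroc W W)).
Proof.
move=> qi Wp CZ; apply: (tri_iso C_tri _ (cone_one_minus qi)).
  exact: perfect_cone.
exact: tri_cone.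
Qed.
End Triangulated.

(** * Killing homology from the bottom *)

Section Devissage.
Local Open Scope ring_scope.
Variables (R : comNzRingType) (p : prime_idealr R).
Hypothesis p_unique : forall q : prime_idealr R, q =i p.

(** Modulo [p] the determinant is [1], so it is a unit; an invertible idempotent is the identity. *)
Lemma idempotent_mx1 r (M : 'M[R]_r) :
  M *m M = M -> (forall i j, M i j - (i == j)%:R \in p) -> M = 1%:M.
Proof.
move=> MM Mp.
have e : map_mx (residue_map p) M = 1%:M.
  apply/matrixP => i j; rewrite !mxE -(rmorph_nat (residue_map p)).
  by apply/eqP; rewrite -Quotient.idealrBE.
have [|y yM] := @notin_prime_unit R p p_unique (\det M).
  apply/negP => detp; have : residue_map p (\det M) == residue_map p 0.
    by rewrite -Quotient.idealrBE subr0.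
  by rewrite -det_map_mx e det1 rmorph0 oner_eq0.
rewrite -[LHS]scale1r -yM -scalerA -(mul_scalar_mx (\det M)) -mul_adj_mx -mulmxA MM.
by rewrite mul_adj_mx scale_scalar_mx yM.
Qed.

(** For a bounded complex of projectives this amounts to the vanishing of homology below [s]; the
    explicit homotopy is what allows the construction to continue in degree [s]. *)
Definition contracted_below (s : int) (X : complex R) : Prop :=
  exists h : forall i j, {linear X i -> X j}, forall i j k, (i < s)%R -> j = i + 1 ->
    i = k + 1 -> forall x, x = cdiff X j i (h i j x) + h k i (cdiff X i k x).

Section Step.
Variables (X : complex R) (s : int) (h : forall i j, {linear X i -> X j}).
Hypothesis hP : forall i j k, (i < s)%R -> j = i + 1 ->
    i = k + 1 -> forall x, x = cdiff X j i (h i j x) + h k i (cdiff X i k x).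

(** A linear retraction of [X s] onto its cycles. When [X] is perfect, it makes the cycles of degree
    [s] finitely generated and projective. *)
Let ret x := x - h (s - 1) s (cdiff X s (s - 1) x).

Lemma ret_linear : linear ret.
Proof. exact: (linearP (idfun \- compl (h (s - 1) s) (cdiff X s (s - 1)))). Qed.

Lemma ret_cycle x : cdiff X s (s - 1) (ret x) = 0.
Proof.
rewrite /ret linearB; apply/eqP; rewrite subr_eq0; apply/eqP.
rewrite [LHS](hP (j := s) (k := s - 1 - 1)); try lia.
by rewrite cdiff_sq linear0 addr0.
Qed.

Lemma ret_id z : cdiff X s (s - 1) z = 0 -> ret z = z.
Proof. by rewrite /ret => ->; rewrite linear0 subr0. Qed.

(** Families are indexed by [nat], with only the first [r] entries meaningful, so that [r] can vary
    without changing their type. *)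
Definition hom_generated (r : nat) (g : nat -> X s) : Prop :=
  (forall k, (k < r)%N -> cdiff X s (s - 1) (g k) = 0) /\
  forall z, cdiff X s (s - 1) z = 0 -> exists (a : nat -> R) y,
    z = \sum_(k < r) a k *: g k + cdiff X (s + 1) s y.

(** Solving a relation for a generator with unit coefficient eliminates this generator; [bump k0]
    skips it. *)
Lemma hom_generated_pred r g (a : nat -> R) y (k0 : 'I_r) :
  hom_generated r g -> \sum_(k < r) a k *: g k = cdiff X (s + 1) s y ->
  a k0 \notin p -> hom_generated r.-1 (fun k => g (bump k0 k)).
Proof.
move=> [gc gP] rel ak; have [b ba] := notin_prime_unit p_unique ak.
have lk k : (k < r.-1)%N -> (bump k0 k < r)%N.
  by move=> kr; have /= := ltn_ord (fintype.lift k0 (Ordinal kr)).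
split=> [k /lk/gc //|z /gP[c [y' ->]]].
exists (fun k => c (bump k0 k) - c k0 * b * a (bump k0 k)), (c k0 * b *: y + y').
rewrite linearP -rel !(@bigD1_ord _ _ _ _ k0 xpredT) //= scalerDr.
rewrite scaler_sumr !addrA; congr (_ + _).
rewrite scalerA -mulrA ba mulr1 addrAC addrC; congr (_ + _).
rewrite -big_split; apply: eq_bigr => k _ /=.
by rewrite scalerA -scalerDl subrK.
Qed.

(** The number of generators is least, so no relation among their classes has a unit coefficient.
    The coefficients [al] and [be] are chosen on the members of a dual basis of [X s] and extended,
    which makes them linear. *)
Lemma minimal_generators : perfect X ->
  exists r (g : nat -> X s) (al : nat -> {linear X s -> R^o}) (be : {linear X s -> X (s + 1)}),
  [/\ forall k, (k < r)%N -> cdiff X s (s - 1) (g k) = 0,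
      forall x, ret x = \sum_(k < r) al k x *: g k + cdiff X (s + 1) s (be x)
    & forall (a : nat -> R) y, \sum_(k < r) a k *: g k = cdiff X (s + 1) s y ->
        forall k : 'I_r, a k \in p].
Proof.
move=> /perfectP[_ Xdb]; have [bs bsP] := Xdb s.
pose retl := mk_linear ret_linear.
have bsz z : cdiff X s (s - 1) z = 0 -> z = \sum_(b <- bs) b.2 z *: ret b.1.
  move=> zc; rewrite -{1}[z]ret_id // -[ret z]/(retl z) {1}(bsP z) linear_sum.
  by apply: eq_bigr => b _; rewrite linearZ.
pose b0 : X s * {linear X s -> R^o} := (0, (\0 : {linear X s -> R^o})).
have exgen : exists r, `[< exists g, hom_generated r g >].
  exists (size bs); apply/asboolP; exists (fun k => ret (nth b0 bs k).1).
  split=> [k _|z zc]; first exact: ret_cycle.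
  exists (fun k => (nth b0 bs k).2 z), 0; rewrite linear0 addr0.
  by rewrite {1}(bsz z) // (big_nth b0) big_mkord.
case: (ex_minnP exgen) => r /asboolP[g gP] rmin.
have [gc ggen] := gP.
have exc z : exists c : (nat -> R) * X (s + 1), cdiff X s (s - 1) z = 0 ->
    z = \sum_(k < r) c.1 k *: g k + cdiff X (s + 1) s c.2.
  have [zc|zc] := pselect (cdiff X s (s - 1) z = 0).
    by have [a [y e]] := ggen _ zc; exists (a, y).
  by exists (fun=> 0, 0).
have [c cP] := choice exc.
exists r, g, (fun k => mk_linear (sum_linear bs (fun b =>
   mk_linear (scale_linear b.2 ((c (ret b.1)).1 k : R^o))))),
  (mk_linear (sum_linear bs (fun b => mk_linear (scale_linear b.2 (c (ret b.1)).2)))).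
split=> // [x|a y rel k].
  rewrite -[ret x]/(retl x) {1}(bsP x) !linear_sum /=.
  under [in RHS]eq_bigr do rewrite scaler_suml.
  rewrite exchange_big -big_split; apply: eq_bigr => b _ /=.
  rewrite -[ret (_ *: _)]/(retl _) !linearZ /= [in LHS](cP (ret b.1) (ret_cycle _)).
  rewrite [LHS]scalerDr scaler_sumr.
  by congr (_ + _); apply: eq_bigr => k _; rewrite scalerA.
apply: contrapT => /negP ak; have := rmin r.-1.
have -> : `[< exists g, hom_generated r.-1 g >].
  by apply/asboolP; exists (fun l => g (bump k l)); apply: hom_generated_pred rel ak.
by move=> /(_ isT); have := ltn_ord k; lia.
Qed.

Section Attach.
Variables (r : nat) (g : nat -> X s) (al : nat -> {linear X s -> R^o}).
Variable be : {linear X s -> X (s + 1)}.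
Hypothesis gc : forall k, (k < r)%N -> cdiff X s (s - 1) (g k) = 0.
Hypothesis retE : forall x, ret x = \sum_(k < r) al k x *: g k + cdiff X (s + 1) s (be x).

Let f i := (r * (i == s))%N.

Lemma ltn_attach i (k : 'I_(f i)) : (k < r)%N.
Proof. by rewrite (leq_trans (ltn_ord k)) // /f; case: (i == s); rewrite ?muln1 ?muln0. Qed.

Definition attach_fun i : {linear splitc R f i -> X i} :=
  rowcomb (fun k : 'I_(f i) => sd X s i (g k)).

Lemma attach_funE i v : attach_fun i v = \sum_k v 0 k *: sd X s i (g k).
Proof. by []. Qed.

Opaque attach_fun.

Lemma attach_comm i j v :
  attach_fun j (cdiff (splitc R f) i j v) = cdiff X i j (attach_fun i v).
Proof.
rewrite [cdiff (splitc R f) _ _ _]/= linear0 attach_funE linear_sum big1 // => k _.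
rewrite linearZ /=; have [ei|ij] := eqVneq s i; last by rewrite same_degree0 // linear0 scaler0.
subst i; rewrite same_degreeE; have [e|ne] := eqVneq s (j + 1).
  have -> : j = s - 1 by rewrite e addrK.
  by rewrite gc ?scaler0 // ltn_attach.
by rewrite cdiff_shape // scaler0.
Qed.

Definition attach : chain_map (splitc R f) X := ChainMap attach_comm.

(** Below [s] this is the homotopy of [X], cut off where it is no longer controlled. In degree [s],
    [al] lifts the class of a cycle to the attached generators, which sit in degree [s + 1] of the
    cone, and [be] bounds what remains. *)
Definition attach_htpy i j : {linear cone attach i -> cone attach j} :=
  pairl
    (mk_linear (sum_linear (enum 'I_(f (j - 1)))
       (fun k => mk_linear (scale_linear
           (compl (al k) (compl (sdl X i s) (@sndl R _ _)))
           (delta_mx 0 k : 'rV[R]_(f (j - 1)))))))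
    (compl ((if (i < s)%R then h i j else \0 : {linear X i -> X j})
            \+ compl (sdl X (s + 1) j) (compl be (sdl X i s))) (@sndl R _ _)).

Lemma attach_htpyE i j z : attach_htpy i j z =
  (\row_k al k (sd X i s z.2), (if (i < s)%R then h i j z.2 else 0)
     + sd X (s + 1) j (be (sd X i s z.2))).
Proof.
apply/pair_eqP/andP; split; apply/eqP => /=; last by case: ifP.
rewrite big_enum [RHS]row_sum_delta.
by apply: eq_bigr => k _; rewrite mxE.
Qed.

Lemma attach_htpyP i j k : (i < s + 1)%R -> j = i + 1 -> i = k + 1 -> forall z,
  z = cdiff (cone attach) j i (attach_htpy i j z)
      + attach_htpy k i (cdiff (cone attach) i k z).
Proof.
move=> lt_is ej ek [v x].
have f0 : f (i - 1) = 0%N by rewrite /f; case: eqVneq; lia.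
have v0 : v = 0 by apply: rV_trivial.
apply/pair_eqP/andP; split; apply/eqP; first by rewrite [LHS]rV_trivial // [RHS]rV_trivial.
rewrite !attach_htpyE v0 /=. rewrite linear0 !linear0 add0r.
have ks : (k < s)%R by lia.
have ks' : k != s by lia.
rewrite ks (same_degree0 (cdiff X i k x) ks') linear0 linear0 addr0.
have [e|ne] := eqVneq i s; last first.
  have lt_s : (i < s)%R by lia.
  rewrite lt_s (same_degree0 x ne) !linear0 addr0.
  rewrite (_ : \row_k0 _ = 0) ?linear0 ?add0r; last first.
    by apply/rowP => l; rewrite !mxE linear0.
  exact: hP.
have ks1 : k = s - 1 by lia.
clear ek; subst i; rewrite ltxx add0r !same_degreeE.
subst j; rewrite same_degreeE.
subst k; apply/eqP; rewrite -subr_eq; apply/eqP.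
(* In degree [s] the homotopy identity is the decomposition [retE]. *)
rewrite -[LHS]/(ret x) retE; congr (_ + _).
rewrite attach_funE linear_sum /=.
transitivity (\sum_(k < f (s + 1 - 1)) al k x *: g k).
  by rewrite (_ : f (s + 1 - 1) = r) // /f addrK eqxx muln1.
apply: eq_bigr => l _; rewrite linearZ /= mxE.
by rewrite sd_comp ?same_degreeE // addrK eqxx.
Qed.
End Attach.
End Step.

Opaque attach_fun.

Lemma contracted_zero (n s : int) (X : complex R) : (forall i, (n < i)%R -> forall x : X i, x = 0) ->
  (n < s)%R -> contracted_below s X -> zero_object X.
Proof.
move=> X0 ns [h hP]; apply/zero_objectP; exists h => i j k ej ek x.
have [lt_is|le_si] := ltP i s; first exact: hP.
have -> : x = 0 by apply: X0; lia.
by rewrite !linear0 addr0.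
Qed.

Lemma contracted_attach (X : complex R) s : perfect X -> contracted_below s X ->
  exists f (u : chain_map (splitc R f) X),
    [/\ fin_supp f, (forall i, i != s -> f i = 0%N) & contracted_below (s + 1) (cone u)].
Proof.
move=> Xp [h hP]; have [r [g [al [be [gc retE _]]]]] := minimal_generators hP Xp.
exists (fun i => r * (i == s))%N, (attach gc).
split; first exact: fin_supp_delta.
  by move=> i /negPf ->; rewrite muln0.
exists (attach_htpy h al be gc) => i j k.
exact: (attach_htpyP hP retE).
Qed.

(** There are no boundaries in the top degree, so the [g k] generate the cycles and the matrix
    [al j (g i)] is idempotent. By minimality it is the identity modulo [p], hence the identity: the
    [g k] are a basis of the cycles, and attaching them leaves no homology. *)
Lemma contracted_top (X : complex R) s : perfect X -> contracted_below s X ->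
  (forall i, (s < i)%R -> forall x : X i, x = 0) ->
  exists f (u : chain_map (splitc R f) X), fin_supp f /\ zero_object (cone u).
Proof.
move=> Xp [h hP] X0; have [r [g [al [be [gc retE rel]]]]] := minimal_generators hP Xp.
exists (fun i => r * (i == s))%N, (attach gc).
split; first exact: fin_supp_delta.
have X1 (x : X (s + 1)) : x = 0 by apply: X0; lia.
have gE (l : 'I_r) : g l = \sum_(k < r) al k (g l) *: g k.
  have := retE (g l); rewrite (X1 (be _)) linear0 addr0 => <-.
  by rewrite gc // linear0 subr0.
have alg (k l : 'I_r) : al k (g l) = (k == l)%:R.
  pose M : 'M[R]_r := \matrix_(i, j) al j (g i).
  have M1 : M = 1%:M.
    apply: idempotent_mx1.
      apply/matrixP => i j; rewrite !mxE [in RHS](gE i) linear_sum.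
      by apply: eq_bigr => m _; rewrite !mxE linearZ.
    move=> i j; rewrite mxE.
    apply: (rel (fun k => al k (g i) - (i == k :> nat)%:R) 0 _ j).
    rewrite linear0 -[RHS](subrr (g i)) {2}(gE i).
    under eq_bigr do rewrite scalerBl.
    rewrite sumrB; congr (_ - _); rewrite (bigD1 i) //= ?eqxx scale1r big1 ?addr0 // => m mi.
    by rewrite eq_sym (negPf (mi : m != i :> nat)) scale0r.
  by have /matrixP/(_ l k) := M1; rewrite !mxE eq_sym.
apply/zero_objectP; exists (attach_htpy h al be gc) => i j k ej ek z.
have [lt_is|le_si] := ltP i (s + 1); first exact: (attach_htpyP hP retE).
case: z => v x; have x0 : x = 0 by apply: X0; lia.
have d0 : cdiff (cone (attach gc)) j i (attach_htpy h al be gc i j (v, 0)) = 0.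
  rewrite attach_htpyE /= !linear0.
  apply/pair_eqP/andP; split; apply/eqP => /=; last by apply: X0; lia.
  by rewrite oppr0.
rewrite x0 d0 add0r attach_htpyE.
apply/pair_eqP/andP; split; apply/eqP => /=; last by apply/esym/X0; lia.
rewrite linear0 addr0.
(* The cone vanishes above degree [s + 1]; in that degree, the duality [alg] between [al] and [g]
   makes the homotopy recover [v]. *)
have [e|ne] := eqVneq i (s + 1); last by rewrite [LHS]rV_trivial 1?[RHS]rV_trivial //; case: eqP; lia.
subst i; have ks : k = s by lia.
subst k; apply/rowP => m; rewrite mxE same_degreeE.
rewrite attach_funE !linear_sum (bigD1 m) //= !linearZ /= sd_comp ?addrK ?eqxx //.
have br (l : 'I_(r * (s + 1 - 1 == s)%R)%N) : (l < r)%N.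
  exact: (ltn_attach (r := r) l).
have alg' (l : 'I_(r * (s + 1 - 1 == s)%R)%N) : al m (g l) = (m == l)%:R.
  exact: (alg (Ordinal (br m)) (Ordinal (br l))).
rewrite same_degreeE alg' eqxx big1 => [|l lm].
  by rewrite addr0 [RHS]mulr1.
rewrite !linearZ /= sd_comp ?addrK ?eqxx //.
have /negPf ml : m != l by apply: contraNneq lm => ->.
by rewrite same_degreeE alg' ml [LHS]mulr0.
Qed.

Lemma contracted_start (X : complex R) n : (forall i : int, (n < absz i)%N -> forall x : X i, x = 0) ->
  contracted_below (- n%:Z) X.
Proof.
move=> X0; exists (fun i j => \0) => i j k lt_i _ _ x /=.
by rewrite linear0 addr0; apply: X0; lia.
Qed.

(* Killing the homology of [X] from the bottom up, by attaching free modules,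
   ends with a contractible complex. *)
Lemma devissage (D : complex R -> Prop) :
  (forall X, perfect X -> zero_object X -> D X) ->
  (forall X f (u : chain_map (splitc R f) X), perfect X -> fin_supp f ->
     D (cone u) -> D X) ->
  forall X, perfect X -> D X.
Proof.
move=> D0 Dcone X Xp; have [[n X0] _] := Xp.
have main (k : nat) : forall Y, perfect Y -> contracted_below (n%:Z - k%:Z) Y ->
    (forall i, (n%:Z < i)%R -> forall x : Y i, x = 0) -> D Y.
  elim: k => [|k IH] Y Yp Yc Y0.
    rewrite subr0 in Yc; have [f [u [fs u0]]] := contracted_top Yp Yc Y0.
    by apply: (Dcone _ _ u) => //; apply: D0 => //; apply: perfect_cone => //; apply: perfect_splitc.
  have [f [u [fs f0 uc]]] := contracted_attach Yp Yc.
  have up : perfect (cone u) by apply: perfect_cone => //; apply: perfect_splitc.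
  apply: (Dcone _ _ u) => //; apply: IH => //.
    by rewrite (_ : n%:Z - k%:Z = n%:Z - k.+1%:Z + 1) //; lia.
  (* The generators are attached to cycles of degree less than [n], so the cone still lives in
     degrees at most [n]. *)
  move=> i lt_i [v x]; apply/pair_eqP/andP; split; apply/eqP => /=; last exact: Y0.
  by apply: rV_trivial; apply: f0; lia.
apply: (main (2 * n)%N) => //.
  by rewrite (_ : _ - _ = - n%:Z); [apply: contracted_start | lia].
by move=> i lt_i; apply: X0; lia.
Qed.

Lemma contracted_cone0 (X : complex R) f (u : chain_map (splitc R f) X) s :
  (forall i, f i = 0%N) -> contracted_below s (cone u) -> contracted_below s X.
Proof.
move=> f0 [h hP].
exists (fun i j => compl (@sndl R _ (X j)) (compl (h i j) (@inrl R ('rV[R]_(f (i - 1))) (X i)))).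
move=> i j k lt_is ej ek x.
have /(congr1 (fun z => z.2)) := hP i j k lt_is ej ek (0, x).
rewrite /= [X in _ = _ + (h k i X).2 -> _](_ : _ = (0, cdiff X i k x)); last first.
  by apply/pair_eqP/andP; split; apply/eqP => /=; rewrite ?oppr0 ?linear0 ?add0r //.
have -> : (h i j (0, x)).1 = 0 by apply: rV_trivial.
by rewrite !linear0 add0r.
Qed.

(** If every minimal family were empty, the homotopy would extend through all degrees. Otherwise
    minimality makes the value of [al 0] on its own generator congruent to [1] modulo [p]; it is a
    unit, and [q] is [al 0] divided by it. *)
Lemma nonzero_homology (X : complex R) : perfect X -> ~ zero_object X ->
  exists s (e : X s) (q : {linear X s -> R^o}),
    [/\ cdiff X s (s - 1) e = 0, q e = 1 & forall y, q (cdiff X (s + 1) s y) \in p].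
Proof.
move=> Xp Xn0; apply: contrapT => noq; apply: Xn0.
have [[n X0] _] := Xp.
have step s : contracted_below s X -> contracted_below (s + 1) X.
  move=> [h hP]; have [r [g [al [be [gc retE rel]]]]] := minimal_generators hP Xp.
  case: r gc retE rel => [|r] gc retE rel.
    apply: (contracted_cone0 (u := attach gc)) => //.
    by exists (attach_htpy h al be gc); apply: (attach_htpyP hP retE).
  case: noq; exists s, (g 0%N).
  have [|b ba] := @notin_prime_unit R p p_unique (al 0%N (g 0%N)).
    apply/negP => ap.
    have : al 0%N (g 0%N) - 1 \in p.
      apply: (rel (fun k => al k (g 0%N) - (k == 0%N)%:R) (- be (g 0%N)) _ ord0).
      under eq_bigr do rewrite scalerBl.
      have := retE (g 0%N); rewrite gc // linear0 subr0 => /esym e.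
      rewrite sumrB [X in _ - X](_ : _ = g 0%N) ?linearN; last first.
        by rewrite (bigD1 ord0) //= scale1r big1 ?addr0 // => -[[|k] ?] //= _; rewrite scale0r.
      by rewrite (canRL (addrK _) e) addrAC subrr sub0r.
    by move=> /(rpredB ap); rewrite opprB addrC subrK idealr1.
  have ql : linear (fun x => b * al 0%N x : R^o).
    by move=> a x y; rewrite linearP mulrDr -[a *: _]/(a * _) mulrCA.
  exists (mk_linear ql); split=> //=; first exact: gc.
  move=> y; apply: idealMr.
  (* A boundary has trivial class, so its coefficients form a relation. *)
  apply: (rel (fun k => al k (cdiff X (s + 1) s y)) (y - be (cdiff X (s + 1) s y)) _ ord0).
  have := retE (cdiff X (s + 1) s y); rewrite cdiff_sq linear0 subr0 => e.
  by rewrite linearB {2}e addrK.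
have all_s (k : nat) : contracted_below (- n%:Z + k%:Z) X.
  elim: k => [|k IH]; first by rewrite addr0; apply: contracted_start.
  by rewrite -addn1 PoszD addrA; apply: step.
apply: (@contracted_zero n%:Z (- n%:Z + (2 * n).+1%:Z)) => //; last by lia.
by move=> i lt_i; apply: X0; lia.
Qed.
End Devissage.

(** * The tensor product as an exact functor *)

Section TensorFunctor.
Local Open Scope ring_scope.
Variable A : comNzRingType.

Lemma sd_nat2 (V W : int -> lmodType A) (h : forall i j, {linear V i -> W j}) a b c d y :
  a = b -> c = d -> sd W c d (h a c y) = h b d (sd V a b y).
Proof. by move=> e1 e2; subst b d; rewrite !same_degreeE. Qed.

Lemma tmap_ext (M N M' N' : lmodType A) (f f' : {linear M -> M'})
    (g g' : {linear N -> N'}) z :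
  (forall x, f x = f' x) -> (forall y, g y = g' y) -> tmap f g z = tmap f' g' z.
Proof.
move=> ef eg; apply: (@tens_ext _ _ _ _ (tmap f g) (tmap f' g')) => m n /=.
by rewrite !tmapE ef eg.
Qed.

Lemma tmap_tmap (M N M' N' M'' N'' : lmodType A) (f : {linear M -> M'})
    (g : {linear N -> N'}) (f' : {linear M' -> M''}) (g' : {linear N' -> N''}) z :
  tmap f' g' (tmap f g z) = tmap (compl f' f) (compl g' g) z.
Proof. exact: tmap_comp. Qed.

Lemma tmapD (M N M' N' : lmodType A) (f : {linear M -> M'}) (g : {linear N -> N'}) z t :
  tmap f g (z + t) = tmap f g z + tmap f g t.
Proof. exact: linearD. Qed.

Lemma tmapZ (M N M' N' : lmodType A) (f : {linear M -> M'}) (g : {linear N -> N'}) a z :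
  tmap f g (a *: z) = a *: tmap f g z.
Proof. exact: linearZ. Qed.

Lemma tmapDr (M N M' N' : lmodType A) (f : {linear M -> M'})
    (g g' G : {linear N -> N'}) z :
  (forall y, G y = g y + g' y) -> tmap f g z + tmap f g' z = tmap f G z.
Proof.
move=> eG; apply: (@tens_ext _ _ _ _ (tmap f g \+ tmap f g') (tmap f G)) => m n /=.
by rewrite !tmapE eG -[g n]scale1r tpureDr !scale1r.
Qed.

Lemma tens_triviall (M N : lmodType A) (z : tens M N) : (forall x : M, x = 0) -> z = 0.
Proof.
move=> M0; rewrite -[z](@tmap_id _ M N idfun idfun) //.
by apply: tmap_eq0l.
Qed.

Lemma tens_trivialr (M N : lmodType A) (z : tens M N) : (forall y : N, y = 0) -> z = 0.
Proof.
move=> N0; rewrite -[z](@tmap_id _ M N idfun idfun) //.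
by apply: tmap_eq0r.
Qed.

Lemma perfect_tensc (X Y : complex A) : perfect X -> perfect Y -> perfect (tensc X Y).
Proof.
move=> /perfectP[[m Xm] Xi] /perfectP[[n Yn] Yi]; apply/perfectP; split.
  exists (m + n)%N => i lt_i z; apply: dsumP => j /=.
  have [lt_j|le_j] := ltnP m (absz j); first by apply: tens_triviall; apply: Xm.
  by apply: tens_trivialr; apply: Yn; lia.
move=> i; apply: (@dsum_dual_basis _ _ m) => [j lt_j x|j].
  by apply: tens_triviall; apply: Xm.
exact: tens_dual_basis.
Qed.

Lemma dsum_map_subproof (V W : int -> lmodType A) (F : forall i, {linear V i -> W i})
  (z : dsum V) : finite_set [set i | F i (z i) != 0]%classic.
Proof.
apply: (sub_finite_set _ (dvalP z)) => i /=; apply: contra_neq => ->.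
exact: linear0.
Qed.
Definition dsum_map_fun (V W : int -> lmodType A) (F : forall i, {linear V i -> W i})
  (z : dsum V) : dsum W := DSum (dsum_map_subproof F z).
Lemma dsum_map_linear (V W : int -> lmodType A) (F : forall i, {linear V i -> W i}) :
  linear (dsum_map_fun F).
Proof. by move=> a x y; apply: dsumP => i /=; rewrite linearP. Qed.
Definition dsum_map (V W : int -> lmodType A) (F : forall i, {linear V i -> W i}) :
  {linear dsum V -> dsum W} := mk_linear (dsum_map_linear F).

Section Functor.
Variables X Y Y' : complex A.

(** Defined for families that need not commute with the differentials, so that it also applies to
    the splittings of an exact sequence. *)
Definition gtmap (g : forall i, {linear Y i -> Y' i}) n :
    {linear tensc X Y n -> tensc X Y' n} :=
  dsum_map (fun i => (tmap idfun (g (n - i)) :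
     {linear tens (X i) (Y (n - i)) -> tens (X i) (Y' (n - i))})).

Lemma gtmap_comm (g : chain_map Y Y') n m z :
  gtmap g m (cdiff (tensc X Y) n m z) = cdiff (tensc X Y') n m (gtmap g n z).
Proof.
apply: dsumP => i /=; rewrite /tensc_comp /= tmapD tmapZ !tmap_tmap.
congr (_ *: _ + _); apply: tmap_ext => // y /=; first by rewrite cmap_diff.
by rewrite (@sd_nat _ Y Y' g (n - (i + 1))).
Qed.
Definition tensc_map (g : chain_map Y Y') : chain_map (tensc X Y) (tensc X Y') :=
  ChainMap (gtmap_comm g).
End Functor.

Lemma tensc_exact (X Y1 Y2 Y3 : complex A) : split_exact Y1 Y2 Y3 ->
  split_exact (tensc X Y1) (tensc X Y2) (tensc X Y3).
Proof.
case=> i q r s ri qs irsq.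
exists (tensc_map X i) (tensc_map X q) (gtmap X r) (gtmap X s) => n z;
  apply: dsumP => k /=; rewrite !tmap_tmap.
- by apply: tmap_id => //= y; rewrite ri.
- by apply: tmap_id => //= y; rewrite qs.
rewrite (@tmapDr _ _ _ _ _ _ _ idfun); first exact: tmap_id.
by move=> y /=; rewrite irsq.
Qed.

(** The homotopy is [1 (x) h] with the Koszul sign [(-1)^i], which cancels the terms containing the
    differential of [X]. *)
Lemma tensc_zero (X Y : complex A) : zero_object Y -> zero_object (tensc X Y).
Proof.
move=> /zero_objectP[h hP]; apply/zero_objectP.
exists (fun n m => dsum_map (fun i => (-1) ^+ absz i \*:
   (tmap idfun (h (n - i) (m - i)) :
     {linear tens (X i) (Y (n - i)) -> tens (X i) (Y (m - i))}))).
move=> n m k -> ek z; apply: dsumP => i /=; rewrite /tensc_comp /=.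
rewrite tmapD !tmapZ !tmap_tmap scalerDr.
rewrite !scalerA -!expr2 !sqrr_sign !scale1r.
rewrite addrACA (@tmapDr _ _ _ _ _ _ _ idfun); last first.
  by move=> y /=; rewrite -hP //; [rewrite addrAC | rewrite ek addrAC].
rewrite tmap_id // sign_int_succ scaleNr (_ : tmap _ _ (z (i + 1)) =
  tmap (compl idfun (cdiff X (i + 1) i))
     (compl (h (k - i) (n - i)) (sdl Y (n - (i + 1)) (k - i))) (z (i + 1))).
  by rewrite addNr addr0.
apply: tmap_ext => // y /=; apply: sd_nat2; first by rewrite ek opprD addrACA subrr addr0.
by rewrite opprD addrACA subrr addr0.
Qed.
End TensorFunctor.

(** * Inserting and evaluating cycles of degree zero *)

Section Units.
Local Open Scope ring_scope.
Variable A : comNzRingType.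

Lemma sd_tpure (X Y : int -> lmodType A) n i k (x : X i) (y : Y (n - i)) :
  sd (fun j => tens (X j) (Y (n - j))) i k (tpure x y)
  = tpure (sd X i k x) (sd Y (n - i) (n - k) y).
Proof.
have [e|ik] := eqVneq i k; first by subst k; rewrite !same_degreeE.
by rewrite !(same_degree0 _ ik) tpure0l.
Qed.

Lemma cdiff_sd (X : complex A) a b c d (x : X a) : a = b -> c = d ->
  cdiff X b d (sd X a b x) = sd X c d (cdiff X a c x).
Proof. by move=> e1 e2; subst b d; rewrite !same_degreeE. Qed.

Lemma tpure_linearr (M N : lmodType A) m : linear (@tpure A M N m).
Proof. by move=> a x y; apply: tpureDr. Qed.
Lemma tpure_linearl (M N : lmodType A) n : linear ((@tpure A M N)^~ n).
Proof. by move=> a x y; apply: tpureDl. Qed.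

Section Insert.
Variables X Y : complex A.
Let V n i : lmodType A := tens (X i) (Y (n - i)).

(** With [e] in degree [0], the map from [y] to [e (x) y] needs no sign; cycles of other degrees are
    first moved there by [delay]. *)
Definition linsert (e : X 0) n : {linear Y n -> tensc X Y n} :=
  compl (dsum_in (V n) 0) (compl (mk_linear (@tpure_linearr (X 0) (Y (n - 0)) e)) (sdl Y n (n - 0))).

Lemma linsertE e n y i :
  linsert e n y i = tpure (sd X 0 i e) (sd Y n (n - i) y) :> V n i.
Proof.
rewrite /= /dsum_in_fun /= sd_tpure; have [<-|i0] := eqVneq 0 i.
  by rewrite sd_comp // eqxx orbT.
by rewrite !(same_degree0 _ i0) !tpure0l.
Qed.

Lemma linsert_comm e : cdiff X 0 (0 - 1) e = 0 -> forall n m y,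
  linsert e m (cdiff Y n m y) = cdiff (tensc X Y) n m (linsert e n y).
Proof.
move=> de n m y; apply: dsumP => i.
rewrite linsertE /= /tensc_comp !(linsertE e y) !tmapE.
rewrite [X in tpure X]/= (_ : cdiff X (i + 1) i _ = 0) ?tpure0l ?addr0; last first.
  have [i1|i1] := eqVneq 0 (i + 1); last by rewrite same_degree0 ?linear0.
  have ei : i = 0 - 1 by lia.
  subst i; rewrite (cdiff_sd (c := 0 - 1)) ?de ?linear0 //.
have [e0|i0] := eqVneq 0 i; last by rewrite !(same_degree0 _ i0) !tpure0l scaler0.
subst i; rewrite expr0 scale1r; congr tpure; apply/esym/cdiff_sd; lia.
Qed.
Definition linsertc e de : chain_map Y (tensc X Y) := ChainMap (@linsert_comm e de).

Definition rinsert (e : Y 0) n : {linear X n -> tensc X Y n} :=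
  compl (dsum_in (V n) n) (mk_linear (@tpure_linearl (X n) (Y (n - n)) (sd Y 0 (n - n) e))).

Lemma rinsertE e n x i :
  rinsert e n x i = tpure (sd X n i x) (sd Y 0 (n - i) e) :> V n i.
Proof.
rewrite /= /dsum_in_fun /= sd_tpure; have [e0|ni] := eqVneq n i.
  by subst i; rewrite sd_comp // eqxx orbT.
by rewrite !(same_degree0 _ ni) !tpure0l.
Qed.

Lemma rinsert_comm e : cdiff Y 0 (0 - 1) e = 0 -> forall n m x,
  rinsert e m (cdiff X n m x) = cdiff (tensc X Y) n m (rinsert e n x).
Proof.
move=> de n m x; apply: dsumP => i.
rewrite rinsertE /= /tensc_comp !(rinsertE e x) !tmapE /=.
rewrite (_ : cdiff Y (n - i) (m - i) _ = 0) ?tpure0r ?scaler0 ?add0r; last first.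
  have [i1|i1] := eqVneq 0 (n - i); last by rewrite same_degree0 ?linear0.
  have [ei|ne] := eqVneq (n - i) (m - i + 1); last by rewrite cdiff_shape.
  by rewrite (cdiff_sd (c := 0 - 1)) ?de ?linear0 //; lia.
have [en|ni] := eqVneq n (i + 1); last first.
  rewrite (same_degree0 _ ni) linear0 tpure0l.
  have [nm|nm] := eqVneq n (m + 1); last by rewrite cdiff_shape // linear0 tpure0l.
  have mi : m != i by lia.
  by rewrite same_degree0 // tpure0l.
subst n; rewrite same_degreeE; have [em|mi] := eqVneq m i.
  subst m; rewrite same_degreeE sd_comp //; lia.
rewrite (same_degree0 _ mi) tpure0l.
by rewrite sd_comp ?(@same_degree0 _ Y 0 (m - i)) ?tpure0r //; lia.
Qed.
Definition rinsertc e de : chain_map X (tensc X Y) := ChainMap (@rinsert_comm e de).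
End Insert.

Section Evaluation.
Variables (M N : lmodType A) (q : {linear M -> A^o}).
Lemma evl_linearl (n : N) : linear (fun m : M => q m *: n).
Proof. exact: scale_linear. Qed.
Lemma evl_linearr (m : M) : linear (fun n : N => q m *: n).
Proof. by move=> a x y; rewrite scalerDr !scalerA mulrC. Qed.
Definition evl : {linear tens M N -> N} := tlift evl_linearl evl_linearr.
Lemma evlE m n : evl (tpure m n) = q m *: n.
Proof. exact: tliftE. Qed.
End Evaluation.

Opaque evl.

Section LeftRetraction.
Variables (X Y : complex A) (e : X 0) (q : {linear X 0 -> A^o}).
Hypotheses (qe : q e = 1) (qd : forall y, q (cdiff X (0 + 1) 0 y) = 0).

(** This is [q (x) 1]; it commutes with the differentials because [q], vanishing on boundaries, is a
    chain map to the unit complex. *)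
Definition lretract n : {linear tensc X Y n -> Y n} :=
  compl (sdl Y (n - 0) n) (compl (evl (Y (n - 0)) q) (dproj (fun i => tens (X i) (Y (n - i))) 0)).

Lemma lretract_comm n m z :
  lretract m (cdiff (tensc X Y) n m z) = cdiff Y n m (lretract n z).
Proof.
rewrite /= /tensc_comp linearD /=.
rewrite [in X in sd _ _ _ (_ + X)]
  (_ : evl _ _ (tmap (cdiff X (0 + 1) 0) _ _) = 0) ?linear0; last first.
  pose F : {linear tens (X (0 + 1)) (Y (n - (0 + 1))) -> Y (m - 0)} :=
    compl (evl _ q) (tmap (cdiff X (0 + 1) 0) (sdl Y (n - (0 + 1)) (m - 0))).
  by apply: (@tens_ext _ _ _ _ F \0) => x y /=; rewrite tmapE evlE qd scale0r.
rewrite [X in sd _ _ _ X](_ : _ = cdiff Y (n - 0) (m - 0) (evl _ q (z 0))); last first.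
  rewrite [LHS]addr0 expr0 scale1r.
  pose F : {linear tens (X 0) (Y (n - 0)) -> Y (m - 0)} :=
    compl (evl _ q) (tmap idfun (cdiff Y (n - 0) (m - 0))).
  apply: (@tens_ext _ _ _ _ F (compl (cdiff Y (n - 0) (m - 0)) (evl _ q))) => x y /=.
  by rewrite tmapE !evlE linearZ.
by symmetry; apply: cdiff_sd; lia.
Qed.
Definition lretractc : chain_map (tensc X Y) Y := ChainMap lretract_comm.

Lemma lretractK n y : lretract n (linsert Y e n y) = y.
Proof.
by rewrite [LHS]/= !same_degreeE evlE qe scale1r sd_comp ?same_degreeE // subr0 eqxx.
Qed.
End LeftRetraction.

Lemma bijective_chain_map (X Y : complex A) (f : chain_map X Y)
    (g : forall n, {linear Y n -> X n}) :
  (forall n x, g n (f n x) = x) -> (forall n y, f n (g n y) = y) ->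
  homotopy_equivalent X Y.
Proof.
move=> gf fg.
have gc n m y : g m (cdiff Y n m y) = cdiff X n m (g n y).
  by rewrite -{1}(fg n y) -cmap_diff gf.
exact: (@iso_homotopy_equivalent _ _ _ f (ChainMap gc)).
Qed.

(** The unit is characterised, as free on [e] and concentrated in degree [0], rather than fixed: it
    occurs as a split complex, whose modules are row spaces. *)
Lemma tensc_unit (X Y : complex A) (e : Y 0) (q : {linear Y 0 -> A^o}) :
  (forall i, i != 0 -> forall y : Y i, y = 0) -> q e = 1 ->
  (forall y, y = q y *: e) -> homotopy_equivalent X (tensc X Y).
Proof.
move=> Y0 qe Ye.
have de : cdiff Y 0 (0 - 1) e = 0 by apply: Y0.
have bl n y : linear (fun x : X n => q (sd Y (n - n) 0 y) *: x).
  by move=> a x x'; rewrite scalerDr !scalerA mulrC.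
have br n x : linear (fun y : Y (n - n) => q (sd Y (n - n) 0 y) *: (x : X n)).
  by move=> a y y'; rewrite !linearP scalerDl scalerA.
pose g n : {linear tensc X Y n -> X n} :=
  compl (tlift (bl n) (br n) : {linear _ -> _}) (dproj (fun i => tens (X i) (Y (n - i))) n).
apply: (@bijective_chain_map _ _ (rinsertc X de) g) => n.
  move=> x; rewrite /g /= /dsum_in_fun /= !same_degreeE tliftE.
  by rewrite sd_comp ?same_degreeE ?qe ?scale1r // subrr eqxx.
move=> z; apply: dsumP => i; rewrite [LHS]rinsertE.
have [ei|ni] := eqVneq n i; last first.
  by rewrite [RHS]tens_trivialr ?(same_degree0 _ ni) ?tpure0l //; apply: Y0; lia.
subst i; rewrite same_degreeE.
pose F : {linear tens (X n) (Y (n - n)) -> tens (X n) (Y (n - n))} :=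
  compl (mk_linear (@tpure_linearl (X n) (Y (n - n)) (sd Y 0 (n - n) e)))
    (tlift (bl n) (br n)).
apply: (@tens_ext _ _ _ _ F idfun) => x y /=.
rewrite tliftE tpureZl -tpureZr -linearZ -Ye /= sd_comp ?same_degreeE //.
by rewrite subrr eqxx.
Qed.
End Units.

(** * Every triangulated subcategory is an ideal *)

Section Ideal.
Local Open Scope ring_scope.

Lemma fin_supp_ind (N : (int -> nat) -> Prop) :
  N (fun=> 0%N) -> (forall f g, N f -> N g -> N (fun i => f i + g i)%N) ->
  (forall a, N (fun i => i == a : nat)) -> forall f, fin_supp f -> N f.
Proof.
move=> N0 ND Na f [n fn].
have Nm (m : nat) a : N (fun i => m * (i == a))%N.
  elim: m => [|m IH]; first by rewrite (_ : (fun _ => _) = fun=> 0%N).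
  rewrite (_ : (fun _ => _) = fun i => (i == a) + m * (i == a))%N; first exact: ND.
  by apply: funext => i; rewrite mulSn.
have fl : forall i, i \notin int_range n -> f i = 0%N.
  by move=> i; rewrite mem_int_range -ltnNge; apply: fn.
elim: (int_range n) f fl {fn} => [|a l IH] f fl.
  by rewrite (_ : f = fun=> 0%N) //; apply: funext => i; apply: fl.
rewrite (_ : f = fun i => f a * (i == a) + (if i == a then 0 else f i))%N.
  apply: ND => //; apply: IH => i il; case: eqVneq => // ia.
  by apply: fl; rewrite inE negb_or ia.
by apply: funext => i; case: eqVneq => [->|_]; rewrite ?muln1 ?muln0 ?addn0.
Qed.

Variables (R : comNzRingType) (p : prime_idealr R).
Hypothesis p_unique : forall q : prime_idealr R, q =i p.
Variable C : complex R -> Prop.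
Hypothesis C_tri : triangulated_subcategory C.

(** The differential of a split complex being zero, the sign in its suspension disappears and the
    suspension is again a split complex. *)
Lemma cone_splitc_exact f (X : complex R) (u : chain_map (splitc R f) X) :
  split_exact X (cone u) (splitc R (fun i => f (i - 1))).
Proof.
pose S := splitc R (fun i => f (i - 1)).
have pc n m z : fstl (splitc R f (m - 1)) (X m) (cdiff (cone u) n m z)
   = cdiff S n m (fstl (splitc R f (n - 1)) (X n) z) by rewrite /= oppr0.
exists (cone_incl u) (@ChainMap _ (cone u) S (fun n => fstl (splitc R f (n - 1)) (X n)) pc)
  (fun n => sndl (splitc R f (n - 1)) (X n))
  (fun n => inll (splitc R f (n - 1)) (X n)) => // n [x y].
by apply/pair_eqP/andP; split; rewrite /= ?add0r ?addr0.
Qed.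

Lemma fin_supp_unit a : fin_supp (fun i => i == a : nat).
Proof.
have := fin_supp_delta 1 a.
by rewrite (_ : (fun _ => _) = fun i => (i == a) : nat) //; apply: funext => i; rewrite mul1n.
Qed.

(** Additivity reduces to rank one in a single degree. Degree [0] is the unit, and adjacent degrees
    are linked by the tensor product of [X] with the contractible cone of an identity. *)
Lemma tensc_splitc X f : C X -> fin_supp f -> C (tensc X (splitc R f)).
Proof.
move=> CX; have Xp := tri_perfect C_tri CX; move: f.
suff H : forall f, fin_supp f -> fin_supp f /\ C (tensc X (splitc R f)).
  by move=> f /H[].
apply: (fin_supp_ind (N := fun f => fin_supp f /\ C (tensc X (splitc R f))))
  => [|f g [ff Cf] [fg Cg]|a].
- have f0 : fin_supp (fun=> 0%N) by exists 0%N.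
  split=> //; apply: (tri_zero C_tri).
    by apply: perfect_tensc => //; apply: perfect_splitc.
  by apply: tensc_zero; apply: trivial_zero_object => i x; apply: rV_trivial.
- have fg' := fin_suppD ff fg; split=> //.
  apply: (tri_exactm C_tri (tensc_exact X (splitc_exact R f g))) => //.
  by apply: perfect_tensc => //; apply: perfect_splitc.
split; first exact: fin_supp_unit.
have Sp b : perfect (tensc X (splitc R (fun i => i == b : nat))).
  by apply: perfect_tensc => //; apply: perfect_splitc; apply: fin_supp_unit.
have step b : C (tensc X (splitc R (fun i => i == b : nat))) <->
    C (tensc X (splitc R (fun i => i == b + 1 : nat))).
  have E := tensc_exact X (cone_splitc_exact (idc (splitc R (fun i => i == b : nat)))).
  have Ccone : C (tensc X (cone (idc (splitc R (fun i => i == b : nat))))).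
    apply: (tri_zero C_tri); last by apply: tensc_zero; apply: cone_id_zero.
    apply: perfect_tensc => //; apply: perfect_cone; apply: perfect_splitc; exact: fin_supp_unit.
  have eb : (fun i => i - 1 == b : nat) = (fun i => i == b + 1 : nat).
    by apply: funext => i; rewrite subr_eq.
  rewrite /= eb in E; split=> Cb.
    exact: (tri_exactr C_tri E).
  exact: (tri_exactl C_tri E).
have base : C (tensc X (splitc R (fun i => i == 0 : nat))).
  apply: (tri_iso C_tri) CX => //.
  have ordE n (j k : 'I_n) : n = 1%N -> j = k by move=> n1; subst n; rewrite !ord1.
  have lt01 : (0 < (0%Z == 0 :> int))%N by [].
  pose e : splitc R (fun i => i == 0 : nat) 0 := const_mx 1.
  pose q : {linear splitc R (fun i => i == 0 : nat) 0 -> R^o} := coord R (Ordinal lt01).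
  apply: (@tensc_unit _ X _ e q) => [i /negPf i0 y||y].
  - by apply: rV_trivial; rewrite i0.
  - by rewrite /= mxE.
  - apply/rowP => j; rewrite !mxE mulr1; congr (y _ _); exact: ordE.
elim: a => [//|n IH|n IH].
  by rewrite (_ : n.+1%:Z = n%:Z + 1); [exact: (step n%:Z).1 | lia].
by apply: (step _).2; rewrite (_ : - n.+1%:Z + 1 = - n%:Z) //; lia.
Qed.

Lemma tensc_ideal X Y : C X -> perfect Y -> C (tensc X Y).
Proof.
move=> CX; have Xp := tri_perfect C_tri CX; move: Y.
apply: (devissage p_unique (D := fun Y => C (tensc X Y))) => [Y Yp Y0|Y f u Yp ff Cu].
  by apply: (tri_zero C_tri); [apply: perfect_tensc | apply: tensc_zero].
apply: (tri_exactl C_tri (tensc_exact X (cone_splitc_exact u))) => //.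
  exact: perfect_tensc.
by apply: tensc_splitc => //; apply: fin_supp_shift.
Qed.
End Ideal.

(** * Multiplying ideals by joins, and density *)

Section Join.
Local Open Scope ring_scope.
Variables (R : comNzRingType) (p : prime_idealr R).
Hypothesis p_unique : forall q : prime_idealr R, q =i p.
Variable C : complex R -> Prop.
Hypothesis C_tri : triangulated_subcategory C.

Opaque linsert rinsert.

(* Some object of [C] contains the unit [R[s]] as a direct summand modulo the
   ideal [J]. *)
Definition splits_unit (s : int) (J : R -> Prop) : Prop :=
  exists (Z : complex R) (e : Z s) (q : {linear Z s -> R^o}),
    [/\ C Z, cdiff Z s (s - 1) e = 0, q e = 1 & forall y, J (q (cdiff Z (s + 1) s y))].

Lemma splits_unit0 s J : splits_unit s J -> splits_unit 0 J.
Proof.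
move=> [Z [e [q [CZ de qe qd]]]].
exists (delay s Z), (sd Z s (0 + s) e), (compl q (sdl Z (0 + s) s)); split.
- exact: tri_delay.
- by rewrite [LHS](cdiff_sd (c := s - 1)) ?de ?linear0 //; lia.
- by rewrite /= sd_comp ?same_degreeE ?qe // add0r eqxx.
move=> y; rewrite /= -(cdiff_sd (X := Z) (b := s + 1)) //.
  by rewrite add0r addrC.
by rewrite add0r.
Qed.

(* The join of [R -> Z] and [R -> X]: up to a shift, the fibre product of [Z] and
   [X] over [Z (x) X]. *)
Section JoinConstruction.
Variables (Z X : complex R) (e : Z 0) (q : {linear Z 0 -> R^o}).
Variables (e' : X 0) (q' : {linear X 0 -> R^o}).
Hypotheses (de : cdiff Z 0 (0 - 1) e = 0) (qe : q e = 1).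
Hypotheses (de' : cdiff X 0 (0 - 1) e' = 0) (qe' : q' e' = 1).

Definition join_half : complex R := cone (rinsertc Z de').
Definition join_map : chain_map X join_half :=
  compc (cone_incl (rinsertc Z de')) (linsertc X de).
Definition join : complex R := cone join_map.

(** Both [e] and [e'] are sent to [e (x) e'], so their difference is a cycle. It has degree [1]
    because the fibre product is built as an iterated cone. *)
Definition join_elt : join 1 := (sd X 0 (1 - 1) e', (- sd Z 0 (1 - 1) e, 0)).

Lemma join_elt_cycle : cdiff join 1 (1 - 1) join_elt = 0.
Proof.
apply/pair_eqP/andP; split; apply/eqP.
  by rewrite [LHS]/= (cdiff_sd (c := 0 - 1)) // de' linear0 oppr0.
have -> : (cdiff join 1 (1 - 1) join_elt).2 =
  join_map (1 - 1) (sd X 0 (1 - 1) e') + cdiff join_half 1 (1 - 1) join_elt.2.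
  by rewrite [LHS]/= same_degreeE.
apply/pair_eqP/andP; split; apply/eqP.
  by rewrite /= linearN opprK [LHS]add0r (cdiff_sd (c := 0 - 1)) // de linear0.
rewrite [LHS]/= same_degreeE [tensc_diff_fun _ _](_ : _ = 0); last first.
  exact: (linear0 (cdiff (tensc Z X) 1 (1 - 1))).
rewrite [LHS]addrA [LHS]addr0.
apply/eqP; rewrite addr_eq0 !same_degreeE linearN opprK; apply/eqP; apply: dsumP => i.
by rewrite !linsertE.
Qed.

Lemma join_form_linl (x : X (1 - 0)) :
  linear (fun z : Z 0 => q z * q' (cdiff X (1 - 0) 0 x) : R^o).
Proof. by move=> a z z'; rewrite linearP mulrDl -scalerAl. Qed.
Lemma join_form_linr (z : Z 0) :
  linear (fun x : X (1 - 0) => q z * q' (cdiff X (1 - 0) 0 x) : R^o).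
Proof. by move=> a x x'; rewrite !linearP mulrDr -scalerAr. Qed.
Definition join_tens : {linear tens (Z 0) (X (1 - 0)) -> R^o} :=
  tlift join_form_linl join_form_linr.
Lemma join_tensE z x : join_tens (tpure z x) = q z * q' (cdiff X (1 - 0) 0 x).
Proof. exact: tliftE. Qed.
Opaque join_tens.

(** By itself [q'] takes values in [J'] on boundaries. But a chain [x] of degree [1] in [X] has in
    its boundary both [- d x] and [e (x) x], and [q (x) q'd] takes the value [q' (d x)] on the
    latter. These cancel, and only products of a value of [q o d] with a value of [q' o d]
    survive. *)
Definition join_form : {linear join 1 -> R^o} :=
  compl q' (compl (sdl X (1 - 1) 0) (@fstl R _ _))
  \+ compl join_tens (compl (dproj (fun i => tens (Z i) (X (1 - i))) 0)
        (compl (@sndl R _ _) (@sndl R (X (1 - 1)) (join_half 1)))).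

Lemma join_form_elt : join_form join_elt = 1.
Proof.
rewrite /= linear0 addr0 sd_comp ?same_degreeE ?qe' //.
Qed.

Lemma join_form_diff (J J' K : R -> Prop) :
  (forall y, J (q (cdiff Z (0 + 1) 0 y))) -> (forall y, J' (q' (cdiff X (0 + 1) 0 y))) ->
  K 0 -> (forall a x y, K x -> K y -> K (a * x + y)) ->
  (forall x y, J x -> J' y -> K (x * y)) ->
  forall y, K (join_form (cdiff join (1 + 1) 1 y)).
Proof.
move=> qd qd' K0 Kcl JJ' [x [z t]].
have -> : cdiff join (1 + 1) 1 (x, (z, t)) =
  (- cdiff X (1 + 1 - 1) (1 - 1) x,
   join_map 1 (sd X (1 + 1 - 1) 1 x) + cdiff join_half (1 + 1) 1 (z, t)).
  by rewrite (@sd_nat _ X join_half join_map).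
have -> : cdiff join_half (1 + 1) 1 (z, t) =
  (- cdiff Z (1 + 1 - 1) (1 - 1) z,
   rinsert Z e' 1 (sd Z (1 + 1 - 1) 1 z) + cdiff (tensc Z X) (1 + 1) 1 t).
  by rewrite (@sd_nat _ Z (tensc Z X) (rinsert Z e')).
have -> : join_map 1 (sd X (1 + 1 - 1) 1 x) = (0, linsert X e 1 (sd X (1 + 1 - 1) 1 x)).
  by [].
rewrite [join_form _]/= -[tensc_comp _ _ _]/(dval (cdiff (tensc Z X) (1 + 1) 1 t) 0).
rewrite !(linearD join_tens).
have -> : join_tens (linsert X e 1 (sd X (1 + 1 - 1) 1 x) 0) =
    q' (cdiff X (1 + 1 - 1) (1 - 1) x).
  by rewrite linsertE join_tensE !same_degreeE qe mul1r.
(* [z (x) e'] lies in the summand [Z 1 (x) X 0], whereas the form reads [Z 0 (x) X 1]. *)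
have -> : join_tens (rinsert Z e' 1 (sd Z (1 + 1 - 1) 1 z) 0) = 0.
  by rewrite rinsertE same_degree0 // tpure0l linear0.
rewrite [sd X (1 - 1) 0 _](same_degreeE (- cdiff X (1 + 1 - 1) (1 - 1) x)) linearN.
rewrite addKr [X in K X]add0r expr0 scale1r.
have -> : join_tens (tmap idfun (cdiff X (1 + 1 - 0) (1 - 0)) (t 0)) = 0.
  pose F : {linear tens (Z 0) (X (1 + 1 - 0)) -> R^o} :=
    compl join_tens (tmap idfun (cdiff X (1 + 1 - 0) (1 - 0))).
  apply: (@tens_ext _ _ _ _ F \0) => u v /=.
  by rewrite tmapE join_tensE cdiff_sq linear0 mulr0.
rewrite [X in K X]add0r.
pose F : {linear tens (Z (0 + 1)) (X (1 + 1 - (0 + 1))) -> R^o} :=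
    compl join_tens (tmap (cdiff Z (0 + 1) 0) (sdl X (1 + 1 - (0 + 1)) (1 - 0))).
apply: (@tens_ind _ _ _ (fun u => K (F u))) => [|a u v Ku Kv|u v].
- by rewrite linear0.
- by rewrite linearP; apply: Kcl.
by rewrite /= tmapE join_tensE; apply: JJ'; [apply: qd | apply: qd'].
Qed.
End JoinConstruction.

Lemma splits_unit_mul (J J' K : R -> Prop) :
  splits_unit 0 J -> splits_unit 0 J' -> K 0 ->
  (forall a x y, K x -> K y -> K (a * x + y)) ->
  (forall x y, J x -> J' y -> K (x * y)) -> splits_unit 0 K.
Proof.
move=> [Z [e [q [CZ de qe qd]]]] [X [e' [q' [CX de' qe' qd']]]] K0 Kcl JJ'.
apply: (@splits_unit0 1); exists (join de de'), (join_elt de de'), (join_form q q' de de'); split.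
- do 2!apply: (tri_cone C_tri) => //.
  by apply: (tensc_ideal p_unique C_tri) => //; apply: tri_perfect CX.
- exact: join_elt_cycle.
- exact: join_form_elt.
exact: (join_form_diff qe qd qd').
Qed.

(** The recursive form isolates the leading generator, which is squared repeatedly until it
    vanishes. *)
Fixpoint in_span (l : seq R) (x : R) : Prop :=
  if l is a :: l' then exists c y, x = c * a + y /\ in_span l' y else x = 0.

Lemma in_span0 l : in_span l 0.
Proof. by elim: l => //= a l IH; exists 0, 0; rewrite mul0r addr0. Qed.

Lemma in_spanP l a x y : in_span l x -> in_span l y -> in_span l (a * x + y).
Proof.
elim: l a x y => [|b l IH] a x y /=; first by move=> -> ->; rewrite mulr0 addr0.
move=> [c [u [-> lu]]] [d [v [-> lv]]]; exists (a * c + d), (a * u + v).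
by split; [rewrite mulrDr mulrDl mulrA addrACA | apply: IH].
Qed.

Lemma in_spanM l a x : in_span l x -> in_span l (a * x).
Proof. by move=> lx; rewrite -[_ * _]addr0; apply: in_spanP => //; apply: in_span0. Qed.

Lemma splits_unit_sub (J K : R -> Prop) s :
  (forall x, J x -> K x) -> splits_unit s J -> splits_unit s K.
Proof.
by move=> JK [Z [e [q [CZ de qe qd]]]]; exists Z, e, q; split=> // y; apply: JK.
Qed.

(** The square of the ideal [(a, l)] lies in [(a^2, l)]: joining an object with itself squares one
    generator and keeps the others. *)
Lemma splits_unit_sqr a l :
  splits_unit 0 (in_span (a :: l)) -> splits_unit 0 (in_span (a ^+ 2 :: l)).
Proof.
move=> h; apply: (splits_unit_mul h h); first exact: in_span0.
  exact: in_spanP.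
move=> x y [c [u [-> lu]]] [d [v [-> lv]]] /=.
exists (c * d), ((c * a) * v + (d * a + v) * u); split.
  by rewrite mulrDl [c * a * _]mulrDr mulrACA -expr2 -addrA [u * _]mulrC.
by apply: in_spanP => //; apply: in_spanM.
Qed.

Lemma splits_unit_nil l : (forall a, a \in l -> exists n, a ^+ n = 0) ->
  splits_unit 0 (in_span l) -> splits_unit 0 (eq^~ 0).
Proof.
elim: l => [//|a l IH] nil hl; apply: IH => [b bl|].
  by apply: nil; rewrite inE bl orbT.
have [n an] := nil a (mem_head _ _).
(* After [n] squarings the exponent is [2 ^ n], which exceeds [n]. *)
have pw k : splits_unit 0 (in_span (a ^+ (2 ^ k) :: l)).
  elim: k => [|k IHk]; first by rewrite expn0 expr1.
  by rewrite expnSr exprM; apply: splits_unit_sqr.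
apply: splits_unit_sub (pw n) => x [c [y [-> ly]]].
suff -> : a ^+ (2 ^ n) = 0 by rewrite mulr0 add0r.
by rewrite -(subnK (ltnW (ltn_expl n (isT : (1 < 2)%N)))) exprD an mulr0.
Qed.

Lemma splits_unit_zero : (exists X, C X /\ ~ zero_object X) -> splits_unit 0 (eq^~ 0).
Proof.
move=> [X [CX X0]]; have Xp := tri_perfect C_tri CX.
have [s [e [q [de qe qd]]]] := nonzero_homology p_unique Xp X0.
have /perfectP[_ /(_ (s + 1))[b bP]] := Xp.
pose b0 : X (s + 1) * {linear X (s + 1) -> R^o} := (0, (\0 : {linear X (s + 1) -> R^o})).
(* These finitely many values generate all values of [q] on boundaries, since the members of a dual
   basis generate [X (s + 1)]. *)
pose v k := q (cdiff X (s + 1) s (nth b0 b k).1).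
apply: (@splits_unit_nil [seq v k | k <- index_iota 0 (size b)]).
  by move=> a /mapP[k _ ->]; apply: (prime_nilpotent p_unique); apply: qd.
apply: (@splits_unit0 s); exists X, e, q; split=> // y.
rewrite (bP y) (big_nth b0) !linear_sum; elim: (index_iota _ _) => [|k l IH].
  by rewrite big_nil.
rewrite big_cons; exists ((nth b0 b k).2 y).
exists (\sum_(k <- l) q (cdiff X (s + 1) s ((nth b0 b k).2 y *: (nth b0 b k).1))).
by split; rewrite ?linearZ.
Qed.

(** For [J = 0] the map [q (x) 1] splits the insertion of [W] into [Z (x) W]. That [W (+) W[1]] lies
    in [C] is the entry to Thomason's classification of dense triangulated subcategories by
    subgroups of the Grothendieck group. *)
Lemma tri_dense W : (exists X, C X /\ ~ zero_object X) -> perfect W ->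
  C (cone (zeroc W W)).
Proof.
move=> /splits_unit_zero[Z [e [q [CZ de qe qd]]]] Wp.
apply: (tri_retract C_tri (i := linsertc W de) (q := lretractc W qd)) => //.
  by move=> n x; apply: (lretractK qe).
exact: (tensc_ideal p_unique C_tri).
Qed.
End Join.

(** * Dimension over a field *)

Section Dimension.
Local Open Scope ring_scope.

Definition has_dim (A : comNzRingType) (V : lmodType A) n : Prop :=
  exists f : {linear V -> 'rV[A]_n}, bijective f.

Lemma bijective_linear (A : comNzRingType) (V W : lmodType A) (f : {linear V -> W}) :
  bijective f -> exists g : {linear W -> V}, cancel f g /\ cancel g f.
Proof.
move=> [g fK gK].
have gl : linear g by move=> a x y; apply: (can_inj fK); rewrite linearP !gK.
by exists (mk_linear gl).
Qed.

Lemma eq_kernel_iso (A : comNzRingType) (V W W' : lmodType A)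
    (f : {linear V -> W}) (g : {linear V -> W'}) :
  (forall w, exists v, f v = w) -> (forall w, exists v, g v = w) ->
  (forall v, f v = 0 <-> g v = 0) -> exists h : {linear W -> W'}, bijective h.
Proof.
move=> fs gs ker; have [s sP] := choice fs; have [t tP] := choice gs.
have fg v : g (s (f v)) = g v.
  by apply/eqP; rewrite -subr_eq0 -linearB; apply/eqP/ker; rewrite linearB sP subrr.
have gf v : f (t (g v)) = f v.
  by apply/eqP; rewrite -subr_eq0 -linearB; apply/eqP/ker; rewrite linearB tP subrr.
have hl : linear (fun w => g (s w)).
  by move=> a x y; rewrite -linearP -[RHS]fg linearP !sP.
exists (mk_linear hl), (fun w => f (t w)) => w /=; first by rewrite gf sP.
by rewrite fg tP.
Qed.

Lemma eq_image_iso (A : comNzRingType) (U U' V : lmodType A)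
    (f : {linear U -> V}) (g : {linear U' -> V}) :
  injective f -> injective g ->
  (forall v, (exists u, f u = v) <-> (exists u, g u = v)) ->
  exists h : {linear U -> U'}, bijective h.
Proof.
move=> fi gi im.
have /choice[h hP] : forall u, exists u', g u' = f u by move=> u; apply/im; exists u.
have /choice[k kP] : forall u', exists u, f u = g u' by move=> u; apply/im; exists u.
have hl : linear h by move=> a x y; apply: gi; rewrite linearP !hP linearP.
exists (mk_linear hl), k => u /=; first by apply: fi; rewrite kP hP.
by apply: gi; rewrite hP kP.
Qed.

Section Field.
Variable F : fieldType.

Lemma injective_row_le n m (f : {linear 'rV[F]_n -> 'rV[F]_m}) :
  injective f -> (n <= m)%N.
Proof.
move=> fi; have /eqP <- : row_free (lin1_mx f).
  rewrite -kermx_eq0; apply/eqP/row_matrixP => i; rewrite row0; apply: fi.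
  by rewrite -mul_rV_lin1 -row_mul mulmx_ker row0 linear0.
exact: rank_leq_col.
Qed.

Lemma has_dim_uniq (V : lmodType F) n m : has_dim V n -> has_dim V m -> n = m.
Proof.
move=> [f /bijective_linear[f' [fK f'K]]] [g /bijective_linear[g' [gK g'K]]].
apply/eqP; rewrite eqn_leq; apply/andP; split.
  by apply: (@injective_row_le _ _ (compl g f')) => x y /(can_inj gK)/(can_inj f'K).
by apply: (@injective_row_le _ _ (compl f g')) => x y /(can_inj fK)/(can_inj g'K).
Qed.

Lemma dimE (V : lmodType F) n : has_dim V n -> Defs.dim V = n.
Proof.
move=> Vn; rewrite /Defs.dim; case: xgetP => [m -> Vm|/(_ n)]; last by case.
exact: has_dim_uniq Vm Vn.
Qed.

(** As [W] is arbitrary, [f] has no matrix whose kernel could be taken. A row space of maximal rank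
    inside the kernel is the whole kernel, since it absorbs any further vector. *)
Lemma kernel_mx n (W : lmodType F) (f : {linear 'rV[F]_n -> W}) :
  exists M : 'M[F]_n, forall v : 'rV_n, (v <= M)%MS <-> f v = 0.
Proof.
pose P k := `[< exists2 M : 'M[F]_n, (forall v : 'rV_n, (v <= M)%MS -> f v = 0) & \rank M = k >].
have exP : exists k, P k.
  exists 0%N; apply/asboolP; exists 0; last exact: mxrank0.
  by move=> v; rewrite submx0 => /eqP ->; rewrite linear0.
have leP k : P k -> (k <= n)%N by move=> /asboolP[M _ <-]; apply: rank_leq_row.
case: (ex_maxnP exP leP) => k /asboolP[M Mf <-] max.
exists M => v; split; first exact: Mf.
move=> fv; have Mv := addsmxSl M v.
have : P (\rank (M + v)%MS).
  apply/asboolP; exists (M + v)%MS => // u /sub_addsmxP[[a b] /= ->].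
  rewrite linearD Mf ?submxMl // add0r.
  by rewrite [b]mx11_scalar mul_scalar_mx linearZ /= fv scaler0.
move=> /max h.
have eqr : \rank M == \rank (M + v)%MS by rewrite eqn_leq h mxrankS.
by apply: submx_trans (addsmxSr M v) _; rewrite -(mxrank_leqif_sup Mv).2.
Qed.

Lemma surjective_has_dim n (W : lmodType F) (f : {linear 'rV[F]_n -> W}) (M : 'M[F]_n) :
  (forall w, exists v, f v = w) -> (forall v : 'rV_n, (v <= M)%MS <-> f v = 0) ->
  has_dim W (n - \rank M).
Proof.
move=> fs Mf; rewrite -mxrank_coker.
(* Multiplication by [cokermx M] has kernel [M] but is not onto in general; its column base keeps
   the kernel and is onto. *)
have ml : linear (mulmxr (col_base (cokermx M)) : 'rV_n -> _) by apply: linearP.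
apply: (@eq_kernel_iso _ _ _ _ f (mk_linear ml)) => // [w|v].
  have /row_fullP[B BC] := col_base_full (cokermx M).
  by exists (w *m B); rewrite -[LHS]/(w *m B *m _) -mulmxA BC mulmx1.
rewrite -Mf submxE /=; split=> [/eqP|vM].
  rewrite -{1}(mulmx_base (cokermx M)) mulmxA => /(congr1 (mulmx^~ (pinvmx (row_base (cokermx M))))).
  by rewrite /= mulmxKp ?row_base_free // mul0mx.
by rewrite -{1}(mulmx_base (cokermx M)) mulmxA vM mul0mx.
Qed.

Lemma injective_has_dim n (U : lmodType F) (f : {linear U -> 'rV[F]_n}) (M : 'M[F]_n) :
  injective f -> (forall v : 'rV_n, (v <= M)%MS <-> exists u, f u = v) ->
  has_dim U (\rank M).
Proof.
move=> fi Mf.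
have ml : linear (mulmxr (row_base M) : 'rV_(\rank M) -> 'rV_n) by apply: linearP.
apply: (@eq_image_iso _ _ _ _ f (mk_linear ml)) => // [x y /=|v].
  exact: (row_free_inj (row_base_free M)).
have -> : (exists u, f u = v) <-> (v <= row_base M)%MS by rewrite -Mf eq_row_base.
split=> [/submxP[u ->]|[u <-]]; first by exists u.
exact: submxMl.
Qed.

End Field.

(* The residue field is only given as a commutative ring. *)
Definition is_field (K : comNzRingType) : Prop :=
  exists F : fieldType, (F : comNzRingType) = K.

Definition fin_dim (A : comNzRingType) (V : lmodType A) : Prop := exists n, has_dim V n.

Lemma has_dimE (K : comNzRingType) (K_field : is_field K) (V : lmodType K) n :
  has_dim V n -> Defs.dim V = n.
Proof. by case: K_field => F eF; subst K; apply: dimE. Qed.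

Lemma fin_dim_surj (K : comNzRingType) (K_field : is_field K) (V W : lmodType K) (f : {linear V -> W}) :
  (forall w, exists v, f v = w) -> fin_dim V -> fin_dim W.
Proof.
case: (K_field) => F eF fs; subst K => -[n [h /bijective_linear[h' [hK h'K]]]].
have [M MP] := kernel_mx (compl f h').
exists (n - \rank M)%N; apply: (surjective_has_dim _ MP) => w.
by have [v <-] := fs w; exists (h v); rewrite /= hK.
Qed.

Lemma dim_exact (K : comNzRingType) (K_field : is_field K)
    (U V W : lmodType K) (f : {linear U -> V}) (g : {linear V -> W}) :
  injective f -> (forall w, exists v, g v = w) ->
  (forall v, g v = 0 <-> exists u, f u = v) -> fin_dim V ->
  [/\ fin_dim U, fin_dim W & Defs.dim V = (Defs.dim U + Defs.dim W)%N].
Proof.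
case: (K_field) => F eF fi gs ex Vf; subst K; case: Vf => n [h hb].
have [h' [hK h'K]] := bijective_linear hb.
have [M MP] := kernel_mx (compl g h').
have Wd : has_dim W (n - \rank M).
  by apply: (surjective_has_dim _ MP) => w; have [v <-] := gs w; exists (h v); rewrite /= hK.
have Ud : has_dim U (\rank M).
  apply: (@injective_has_dim _ _ _ (compl h f)) => [x y /(can_inj hK)/fi //|v].
  rewrite MP /= ex; split=> [[u e]|[u <-]]; exists u; first by rewrite /= e h'K.
  by rewrite /= hK.
split; [by exists (\rank M)|by exists (n - \rank M)%N|].
rewrite (@dimE _ V n) ?(dimE Ud) ?(dimE Wd) ?subnKC ?rank_leq_row //.
by exists h.
Qed.

Lemma dim_trivial (K : comNzRingType) (K_field : is_field K) (V : lmodType K) :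
  (forall x : V, x = 0) -> Defs.dim V = 0%N.
Proof.
move=> V0; apply: (has_dimE K_field); exists \0; exists (fun=> 0) => x; first exact/esym.
by apply/rowP => -[].
Qed.
End Dimension.

(** * Euler characteristics of chains and of homology *)

Section EulerPoincare.
Local Open Scope ring_scope.

Definition alternating_sum (n : nat) (h : int -> nat) : int :=
  \sum_(i <- int_range n) (-1) ^+ absz i * (h i)%:Z.

Lemma fsbig_int_range n (F : int -> int) : (forall i, (n < absz i)%N -> F i = 0) ->
  \sum_(i \in [set: int]%classic) F i = \sum_(i <- int_range n) F i.
Proof.
move=> F0; rewrite [RHS](fsbig_seq _ F) ?int_range_uniq //.
symmetry; apply: (fsbig_widen [set` int_range n]%classic setT F) => // i [_ /= /negP].
by rewrite mem_int_range -ltnNge => /F0.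
Qed.

Lemma alternating_sumD n h k l : (forall i, h i = (k i + l i)%N) ->
  alternating_sum n h = alternating_sum n k + alternating_sum n l.
Proof.
move=> e; rewrite -big_split; apply: eq_bigr => i _.
by rewrite e PoszD mulrDr.
Qed.

(** The difference of the two sides telescopes to end terms in [h (- n)] and [h (n + 1)]. *)
Lemma alternating_sum_shift n h : h (- n%:Z) = 0%N -> h (n%:Z + 1) = 0%N ->
  alternating_sum n (fun i => h (i + 1)) = - alternating_sum n h.
Proof.
move=> h0 h1; apply/eqP; rewrite -addr_eq0 -big_split /=.
rewrite big_map -[X in iota 0 X]subn0 -/(index_iota _ _).
pose T k := - (-1) ^+ absz (k%:Z - n%:Z) * (h (k%:Z - n%:Z))%:Z.
rewrite (eq_bigr (fun k => T k.+1 - T k)) => [|k _].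
  rewrite telescope_sumr // /T (_ : (2 * n).+1%:Z - n%:Z = n%:Z + 1) ?h1; last by lia.
  by rewrite sub0r h0 !mulr0 subrr.
rewrite /T (_ : k.+1%:Z - n%:Z = k%:Z - n%:Z + 1); last by lia.
by rewrite sign_int_succ opprK mulNr opprK.
Qed.

Variables (K : comNzRingType) (X : complex K) (n : nat).
Hypothesis K_field : is_field K.
Hypothesis X_fin : forall i, fin_dim (X i).
Hypothesis X0 : forall i, (n < absz i)%N -> forall x : X i, x = 0.

(** The chains modulo the cycles stand for the boundaries of degree [i - 1], onto which the
    differential maps them isomorphically. *)
Let Q i : lmodType K := quotmod (Submodule (@cycle_closed K X i)).

Lemma cycle_val_linear i : linear (@cycle_val K X i).
Proof. by []. Qed.

Lemma dim_cycles i : [/\ fin_dim (cycles X i), fin_dim (Q i) &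
  Defs.dim (X i) = (Defs.dim (cycles X i) + Defs.dim (Q i))%N].
Proof.
apply: (@dim_exact _ K_field _ _ _ (mk_linear (@cycle_val_linear i)) (qclass _)) => //.
- by move=> x y; apply: val_inj.
- by move=> w; have [y] := qclass_surj w; exists y.
move=> v; rewrite -(raddf0 (qclass (Submodule (@cycle_closed K X i)))).
split=> [/eqP|[u <-]]; last by apply/eqP; rewrite qclass_eq subr0; apply: cycle_valP.
by rewrite qclass_eq subr0 => vc; exists (Cycle vc).
Qed.

Lemma boundary_subproof i (x : X (i + 1)) : cycle_pred (cdiff X (i + 1) i x).
Proof. by rewrite /cycle_pred cdiff_sq. Qed.
Definition boundary_fun i (x : X (i + 1)) : cycles X i := Cycle (boundary_subproof x).
Lemma boundary_linear i : linear (@boundary_fun i).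
Proof. by move=> a x y; apply: val_inj; apply: linearP. Qed.

Lemma cdiff_pred_eq0 i j k (x : X i) : j = k -> cdiff X i j x = 0 <-> cdiff X i k x = 0.
Proof. by move=> e; subst k. Qed.

Lemma boundary_eq0 i x : x \in smem (Submodule (@cycle_closed K X (i + 1))) ->
  mk_linear (@boundary_linear i) x = 0.
Proof.
move=> /eqP dx; apply: val_inj; rewrite /=.
by apply: (cdiff_pred_eq0 x (addrK 1 i)).1.
Qed.

Lemma dim_boundaries i :
  Defs.dim (cycles X i) = (Defs.dim (Q (i + 1)) + Defs.dim (homology X i))%N.
Proof.
have [cf _ _] := dim_cycles i.
have [] // := @dim_exact _ K_field _ _ _ (qlift (@boundary_eq0 i))
  (qclass _ : {linear cycles X i -> homology X i}).
- move=> x y; have [x' <-] := qclass_surj x; have [y' <-] := qclass_surj y.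
  rewrite !qliftE => e; apply/eqP; rewrite qclass_eq; apply/eqP.
  apply: (cdiff_pred_eq0 _ (addrK 1 i)).2.
  by rewrite linearB; move/(congr1 (@cycle_val K X i)): e => /= ->; rewrite subrr.
- by move=> w; have [y] := qclass_surj w; exists y.
move=> v; rewrite -[X in _ = X](raddf0 (qclass (Submodule (@boundary_closed K X i)))).
split=> [/eqP|[u]].
  rewrite qclass_eq subr0 => /asboolP[y yv]; exists (qclass _ y).
  by rewrite qliftE; apply: val_inj.
have [u' <-] := qclass_surj u; rewrite qliftE => <-.
by apply/eqP; rewrite qclass_eq subr0; apply/asboolP; exists u'.
Qed.

(** The dimensions of [Q] enter once as they are and once shifted by one degree, and cancel. Summing
    up to [n.+1] instead of [n] places the end terms of this shift outside the support of [X]. *)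
Lemma euler_poincare :
  \sum_(i \in [set: int]%classic) (-1) ^+ absz i * (Defs.dim (homology X i))%:Z
  = alternating_sum n.+1 (fun i => Defs.dim (X i)).
Proof.
have Q0 i : (n < absz i)%N -> Defs.dim (Q i) = 0%N.
  move=> ni; apply: (dim_trivial K_field) => x; have [y <-] := qclass_surj x.
  by rewrite (X0 ni y) raddf0.
have Z0 i : (n < absz i)%N -> Defs.dim (cycles X i) = 0%N.
  by move=> ni; apply: (dim_trivial K_field) => x; apply: val_inj; apply: X0.
rewrite (@fsbig_int_range n.+1) => [|i ni]; last first.
  have := dim_boundaries i; rewrite Z0; last by lia.
  by move/esym/eqP; rewrite addn_eq0 => /andP[_ /eqP ->]; rewrite mulr0.
rewrite -/(alternating_sum n.+1 (fun i => Defs.dim (homology X i))).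
rewrite (@alternating_sumD _ (fun i => Defs.dim (X i))
  (fun i => Defs.dim (cycles X i)) (fun i => Defs.dim (Q i))).
  rewrite (@alternating_sumD _ (fun i => Defs.dim (cycles X i)) (fun i => Defs.dim (Q (i + 1)))
     (fun i => Defs.dim (homology X i))); last exact: dim_boundaries.
  rewrite (@alternating_sum_shift _ (fun i => Defs.dim (Q i))).
  - by rewrite addrAC addNr add0r.
  - by apply: Q0; lia.
  - by apply: Q0; lia.
by move=> i; have [] := dim_cycles i.
Qed.
End EulerPoincare.

(** * Additivity of [Lambda] *)

Section LambdaTheory.
Local Open Scope ring_scope.
Local Open Scope quotient_scope.
Variables (R : comNzRingType) (p : prime_idealr R).
Hypothesis p_unique : forall q : prime_idealr R, q =i p.

Local Notation K := {ideal_quot p}.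
Local Notation phi := (residue_map p).
Local Notation ext M := (ext_scalars phi M).
(* [R/p] as an [R]-module *)
Local Notation kR := (Defs_restr__canonical__GRing_Lmodule phi).

Lemma residue_is_field : is_field K.
Proof.
have inv_ex (x : K) : exists y : K, (x != 0 -> y * x = 1) /\ (x = 0 -> y = 0).
  have [->|x0] := eqVneq x 0; first by exists 0; split.
  have ex : phi (repr x) = x by apply: reprK.
  have rp : repr x \notin p.
    apply: contraNN x0 => rp; rewrite -ex -(rmorph0 phi).
    by rewrite -Quotient.idealrBE subr0.
  have [y yx] := notin_prime_unit p_unique rp; exists (phi y).
  split=> [_|x00]; last by rewrite x00 eqxx in x0.
  by rewrite -[X in _ * X]ex -rmorphM yx rmorph1.
have [inv invP] := choice inv_ex.
pose F : fieldType := HB.pack K (GRing.ComNzRing_isField.Build K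
  (fun x => (invP x).1) ((invP 0).2 erefl)).
by exists F.
Qed.

Lemma ext_generated (M : lmodType R) (s : seq (M * {linear M -> R^o})) :
  (forall x, x = \sum_(b <- s) b.2 x *: b.1) ->
  forall z : ext M, exists v : 'rV[K]_(size s),
    z = \sum_k v 0 k *: (tpure (tnth (in_tuple s) k).1 ((1 : K) : kR) : ext M).
Proof.
move=> sP; apply: tens_ind => [|a x y [v ->] [w ->]|m b].
- by exists 0; rewrite big1 // => k _; rewrite mxE scale0r.
- exists (phi a *: v + w).
  have -> (z : ext M) : a *: (z : tens M kR) = phi a *: z.
    rewrite -[RHS]/(tmap idfun (restr_mul phi (phi a)) z).
    apply: (@tens_ext _ _ _ _ (a \*: idfun) (tmap idfun (restr_mul phi (phi a)))) => m b /=.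
    by rewrite tmapE /= -tpureZr.
  rewrite scaler_sumr -[LHS]big_split; apply: eq_bigr => k _ /=.
  by rewrite !mxE scalerDl scalerA.
exists (\row_k (phi ((tnth (in_tuple s) k).2 m) * b)).
have -> : tpure m b = mk_linear (@tpure_linearl R M kR b) m by [].
rewrite [in LHS](sP m) big_tnth linear_sum.
apply: eq_bigr => k _ /=; rewrite mxE tpureZl -tpureZr.
rewrite -[RHS]/(tmap idfun (restr_mul phi _) (tpure _ _)) tmapE /=.
by congr tpure; rewrite mulr1.
Qed.

Lemma ext_fin_dim (M : lmodType R) : has_dual_basis M -> fin_dim (ext M).
Proof.
move=> [s sP].
apply: (@fin_dim_surj _ residue_is_field 'rV[K]_(size s) (ext M)
   (rowcomb (fun k => (tpure (tnth (in_tuple s) k).1 ((1 : K) : kR) : ext M)))).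
  by move=> z; have [v e] := ext_generated sP z; exists v; rewrite e.
by exists (size s), idfun; exists idfun.
Qed.

Definition rk (M : lmodType R) : nat := Defs.dim (ext M).

Lemma ext_map_id (M : lmodType R) (f : {linear M -> M}) z :
  (forall x, f x = x) -> ext_map phi f z = z.
Proof. by move=> fx; apply: tmap_id. Qed.

Lemma ext_map_comp (L M N : lmodType R) (g : {linear M -> N}) (f : {linear L -> M}) z :
  ext_map phi g (ext_map phi f z) = ext_map phi (compl g f) z.
Proof. exact: tmap_comp. Qed.

Lemma ext_mapD (M N : lmodType R) (f g h : {linear M -> N}) z :
  (forall x, h x = f x + g x) -> ext_map phi f z + ext_map phi g z = ext_map phi h z.
Proof.
move=> eh; apply: (@tens_ext _ _ _ _ (tmap f idfun \+ tmap g idfun) (tmap h idfun)) => m n /=.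
by rewrite !tmapE eh -[f m]scale1r tpureDl !scale1r.
Qed.

Lemma rk_exact (U V W : lmodType R) (i : {linear U -> V}) (q : {linear V -> W})
    (r : {linear V -> U}) (s : {linear W -> V}) :
  (forall u, r (i u) = u) -> (forall w, q (s w) = w) ->
  (forall v, i (r v) + s (q v) = v) -> has_dual_basis V -> rk V = (rk U + rk W)%N.
Proof.
move=> ri qs irsq Vd.
have rie z : ext_map phi r (ext_map phi i z) = z.
  by rewrite ext_map_comp; apply: ext_map_id.
have qse z : ext_map phi q (ext_map phi s z) = z.
  by rewrite ext_map_comp; apply: ext_map_id.
have qi u : q (i u) = 0.
  have := irsq (i u); rewrite ri => /(congr1 q); rewrite linearD qs => /eqP.
  by rewrite -subr_eq0 addrK => /eqP.
have [] // := @dim_exact _ residue_is_field _ _ _ (ext_map phi i) (ext_map phi q).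
- exact: can_inj rie.
- by move=> w; exists (ext_map phi s w).
- move=> v; split=> [qv|[u <-]]; last first.
    by rewrite ext_map_comp; apply: tmap_eq0l.
  exists (ext_map phi r v); rewrite ext_map_comp.
  have := @ext_mapD _ _ (compl i r) (compl s q) idfun v (fun x => esym (irsq x)).
  by rewrite -(ext_map_comp s q) qv linear0 addr0 => ->; apply: ext_map_id.
exact: ext_fin_dim.
Qed.

Lemma rk_row n : rk 'rV[R]_n = n.
Proof.
apply: (has_dimE residue_is_field).
have [s sP] : exists s : seq ('rV[R]_n * {linear 'rV[R]_n -> R^o}),
    forall x, x = \sum_(b <- s) b.2 x *: b.1 by apply: row_dual_basis.
have bl j (b : kR) : linear (fun v : 'rV[R]_n => (phi (v 0 j) * (b : K) : kR)).
  by move=> a v w; rewrite !mxE rmorphD rmorphM mulrDl -mulrA.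
have br j (v : 'rV[R]_n) : linear (fun b : kR => (phi (v 0 j) * (b : K) : kR)).
  by move=> a b b'; rewrite mulrDr [X in X + _]mulrCA.
pose T j : {linear tens 'rV[R]_n kR -> kR} := tlift (bl j) (br j).
have TZ j (a : K) (z : ext 'rV[R]_n) : T j (a *: z) = a * (T j z : K).
  rewrite -[a *: z]/(tmap idfun (restr_mul phi a) z).
  apply: (@tens_ext _ _ _ _ (compl (T j) (tmap idfun (restr_mul phi a)))
    (compl (restr_mul phi a) (T j))) => v b /=.
  by rewrite tmapE /= !tliftE mulrCA.
have fl : linear (fun z : ext 'rV[R]_n => \row_j (T j z : K)).
  by move=> a x y; apply/rowP => j; rewrite !mxE linearD TZ.
exists (mk_linear fl).
pose e j : ext 'rV[R]_n := tpure (delta_mx 0 j : 'rV[R]_n) ((1 : K) : kR).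
exists (rowcomb e) => z.
  rewrite /=; move: z.
  have gl : linear (rowcomb e) by apply: linearP.
  pose G j : {linear tens 'rV[R]_n kR -> tens 'rV[R]_n kR} :=
    compl (mk_linear (@tpure_linearr R 'rV[R]_n kR (delta_mx 0 j))) (T j).
  have GE z : \sum_k (\row_j (T j z : K)) 0 k *: e k = \sum_j G j z.
    apply: eq_bigr => k _; rewrite mxE -[LHS]/(tmap idfun (restr_mul phi _) (tpure _ _)) tmapE /=.
    by congr tpure; rewrite mulr1.
  move=> z; rewrite GE.
  apply: (@tens_ext _ _ _ _ (mk_linear (sum_linear (index_enum 'I_n) G)) idfun) => v b /=.
  have -> : tpure v b = mk_linear (@tpure_linearl R 'rV[R]_n kR b) v by [].
  rewrite [in RHS](row_sum_delta v) linear_sum.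
  by apply: eq_bigr => j _; rewrite /= tpureZl -tpureZr tliftE.
change (\row_j (T j (rowcomb e z) : K) = z :> 'rV[K]_n).
have Te j k : T j (e k) = ((k == j)%:R : K).
  by rewrite /= tliftE !mxE eqxx /= rmorph_nat mulr1 eq_sym.
apply/rowP => j; rewrite mxE linear_sum.
rewrite (eq_bigr (fun k => z 0 k * ((k == j)%:R : K))) => [|k _]; last by rewrite TZ Te.
by rewrite (bigD1 j) //= eqxx mulr1 big1 ?addr0 // => k /negPf ->; rewrite mulr0.
Qed.

(** With homology replaced by ranks, additivity holds degree by degree and no long exact sequence is
    involved. *)
Lemma Lambda_rk X n : perfect X -> (forall i, (n < absz i)%N -> forall x : X i, x = 0) ->
  Lambda p X = alternating_sum n.+1 (fun i => rk (X i)).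
Proof.
move=> /perfectP[_ Xd] X0.
apply: (@euler_poincare _ (extc phi X) n residue_is_field) => [i|i ni z].
  exact: ext_fin_dim.
by apply: tens_triviall; apply: X0.
Qed.

Lemma Lambda_exact X Y Z (E : split_exact X Y Z) :
  perfect X -> perfect Y -> perfect Z -> Lambda p Y = Lambda p X + Lambda p Z.
Proof.
move=> Xp Yp Zp; have [[l X0] _] := Xp; have [[m Y0] _] := Yp; have [[n Z0] _] := Zp.
pose N := (l + m + n)%N.
rewrite (@Lambda_rk X N) // ?(@Lambda_rk Y N) // ?(@Lambda_rk Z N) //.
- apply: alternating_sumD => i.
  have /perfectP[_ /(_ i) Yd] := Yp.
  exact: (@rk_exact _ _ _ (se_i E i) (se_p E i) (se_r E i) (se_s E i)
    (fun u => se_ri E u) (fun w => se_ps E w) (fun v => se_id E v) Yd).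
- by move=> i lt_i; apply: Z0; lia.
- by move=> i lt_i; apply: Y0; lia.
- by move=> i lt_i; apply: X0; lia.
Qed.

Lemma Lambda_zero X : zero_object X -> Lambda p X = 0.
Proof.
move=> /zero_objectP[h hP]; apply: fsbig1 => i _.
suff -> : Defs.dim (homology (extc phi X) i) = 0%N by rewrite mulr0.
apply: (dim_trivial residue_is_field) => x; have [z <-] := qclass_surj x.
apply/eqP; rewrite -(raddf0 (qclass _)) qclass_eq subr0; apply/asboolP.
exists (ext_map phi (h i (i + 1)) (cycle_val z)).
have /eqP zc := cycle_valP z.
have := @ext_mapD _ _ (compl (cdiff X (i + 1) i) (h i (i + 1)))
  (compl (h (i - 1) i) (cdiff X i (i - 1))) idfun (cycle_val z).
rewrite (ext_map_id _ (f := idfun)) // => e.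
rewrite -[RHS]e; last by move=> y; apply: hP; rewrite ?subrK.
by rewrite -!ext_map_comp [ext_map phi (cdiff X i (i - 1)) _]zc linear0 addr0.
Qed.

(** Additivity along the contractible cone of the identity. *)
Lemma Lambda_shift X : perfect X -> Lambda p (shift X) = - Lambda p X.
Proof.
move=> Xp; have Sp := perfect_shift Xp; have Cp := perfect_cone (idc X) Xp Xp.
have := Lambda_exact (cone_split_exact (idc X)) Xp Cp Sp.
by rewrite (Lambda_zero (cone_id_zero X)) => /esym/eqP; rewrite addrC addr_eq0 => /eqP.
Qed.

Lemma Lambda_cone X Y (f : chain_map X Y) : perfect X -> perfect Y ->
  Lambda p (cone f) = Lambda p Y - Lambda p X.
Proof.
move=> Xp Yp; rewrite (Lambda_exact (cone_split_exact f)) ?Lambda_shift //.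
  exact: perfect_cone.
exact: perfect_shift.
Qed.

Lemma Lambda_splitc f n : (forall i, (n < absz i)%N -> f i = 0%N) ->
  Lambda p (splitc R f) = alternating_sum n.+1 f.
Proof.
move=> fn; rewrite (@Lambda_rk _ n).
- by apply: eq_bigr => i _; rewrite rk_row.
- by apply: perfect_splitc; exists n.
by move=> i ni x; apply: rV_trivial; apply: fn.
Qed.
End LambdaTheory.

(** * Classification by the Euler characteristic *)

Section Classification.
Local Open Scope ring_scope.
Variables (R : comNzRingType) (p : prime_idealr R).
Hypothesis p_unique : forall q : prime_idealr R, q =i p.
Variable C : complex R -> Prop.
Hypothesis C_tri : triangulated_subcategory C.
Hypothesis C_nonzero : exists X, C X /\ ~ zero_object X.

Lemma Lambda_splitcD f g : fin_supp f -> fin_supp g ->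
  Lambda p (splitc R (fun i => f i + g i)%N)
  = Lambda p (splitc R f) + Lambda p (splitc R g).
Proof.
move=> ff fg; apply: (Lambda_exact p_unique (splitc_exact R f g)); apply: perfect_splitc => //.
exact: fin_suppD.
Qed.

(** The ranks of [W (+) W[1]] for the split complex [W] of ranks [c]. *)
Definition doubled (c : int -> nat) (i : int) : nat := (c (i - 1)%R + c i)%N.

Lemma fin_supp_doubled c : fin_supp c -> fin_supp (doubled c).
Proof. by move=> fc; apply: fin_suppD => //; apply: fin_supp_shift. Qed.

Lemma Lambda_doubled c : fin_supp c -> Lambda p (splitc R (doubled c)) = 0.
Proof.
move=> fc; have fc' := fin_supp_shift (- 1) fc.
rewrite Lambda_splitcD // addrC.
rewrite -(Lambda_exact p_unique (cone_splitc_exact (idc (splitc R c)))).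
- exact: (Lambda_zero p_unique (cone_id_zero _)).
- exact: perfect_splitc.
- by apply: perfect_cone; apply: perfect_splitc.
exact: perfect_splitc.
Qed.

Lemma tri_doubled c : fin_supp c -> C (splitc R (doubled c)).
Proof.
move=> fc; have Sp := perfect_splitc R fc.
apply: (tri_iso C_tri _ _ (tri_dense p_unique C_tri C_nonzero Sp)).
  by apply: perfect_splitc; apply: fin_supp_doubled.
pose V i : lmodType R := ('rV[R]_(c (i - 1)) * 'rV[R]_(c i))%type.
have fl i : linear (fun z : V i => row_mx z.1 z.2 : 'rV[R]_(doubled c i)).
  by move=> a x y; rewrite scale_row_mx add_row_mx.
have gl i : linear (fun v : 'rV[R]_(doubled c i) =>
    (lsubmx (v : 'rV[R]_(c (i - 1)%R + c i)), rsubmx (v : 'rV[R]_(c (i - 1)%R + c i))) : V i).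
  by move=> a x y; apply/pair_eqP/andP; split; rewrite /= linearP.
have fc0 i j z : mk_linear (fl j) (cdiff (cone (zeroc (splitc R c) (splitc R c))) i j z)
    = cdiff (splitc R (doubled c)) i j (mk_linear (fl i) z).
  by rewrite /= !linear0 addr0 row_mx0.
apply: (@bijective_chain_map _ _ (splitc R (doubled c))
  (@ChainMap R (cone (zeroc (splitc R c) (splitc R c))) (splitc R (doubled c))
     (fun i => mk_linear (fl i)) fc0) (fun i => mk_linear (gl i))).
  by move=> i [x y]; rewrite /= row_mxKl row_mxKr.
by move=> i x; rewrite /= hsubmxK.
Qed.

Lemma alternating_sum_delta n m a : (absz a <= n)%N ->
  alternating_sum n (fun i => m * (i == a))%N = (-1) ^+ absz a * m%:Z.
Proof.
move=> an; rewrite /alternating_sum (bigD1_seq a) ?int_range_uniq ?mem_int_range //=.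
rewrite eqxx muln1 big1 ?addr0 // => i /negPf ->.
by rewrite muln0 mulr0.
Qed.

Lemma splitc_pair f a : (forall i, i != a -> i != a + 1 -> f i = 0%N) ->
  Lambda p (splitc R f) = 0 -> f = doubled (fun i => f a * (i == a))%N.
Proof.
move=> f0.
have fE i : f i = (f a * (i == a) + f (a + 1)%R * (i == a + 1)%R)%N.
  have [->|ia] := eqVneq i a.
    by rewrite (_ : (a == a + 1) = false) ?muln1 ?muln0 ?addn0 //; apply/eqP; lia.
  have [->|ia1] := eqVneq i (a + 1); first by rewrite muln0 muln1.
  by rewrite !muln0 f0.
rewrite (@Lambda_splitc _ _ p_unique f (absz a).+1); last first.
  by move=> i lt_i; apply: f0; apply/eqP; lia.
rewrite (alternating_sumD _ fE) !alternating_sum_delta; try lia.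
rewrite sign_int_succ mulNr -mulrBr => /eqP; rewrite mulf_eq0 signr_eq0 /= subr_eq0.
by move=> /eqP[ea]; apply: funext => i; rewrite fE /doubled -ea addnC subr_eq.
Qed.

(** The support is a window of [k + 2] degrees starting at [a]. As [C] contains [R[a] (+) R[a+1]]
    and [R[a+1] (+) R[a+2]], the rank in degree [a] can be moved to [a + 2], which shortens the
    window. In two adjacent degrees, a vanishing Euler characteristic forces equal ranks. *)
Lemma splitc_null_aux (k : nat) : forall a f,
  (forall i, (i < a) || (a + k%:Z + 2 <= i) -> f i = 0%N) ->
  Lambda p (splitc R f) = 0 -> C (splitc R f).
Proof.
have finf a f l : (forall i, (i < a) || (a + l%:Z + 2 <= i) -> f i = 0%N) -> fin_supp f.
  by move=> f0; exists (absz a + l + 2)%N => i lt_i; apply: f0; lia.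
elim: k => [|k IH] a f f0 Lf.
  rewrite (@splitc_pair f a) // => [|i ia ia1]; last by apply: f0; lia.
  by apply: tri_doubled; apply: fin_supp_delta.
have ff := finf _ _ _ f0.
pose c i := (f a * (i == a)%R)%N.
pose c' i := (f a * (i == a + 1)%R)%N.
pose f' i := ((if i == a then 0 else f i) + f a * (i == a + 2)%R)%N.
have fc : fin_supp c by apply: fin_supp_delta.
have fc' : fin_supp c' by apply: fin_supp_delta.
have f'0 i : (i < a + 1) || (a + 1 + k%:Z + 2 <= i) -> f' i = 0%N.
  move=> lt_i; rewrite /f' (_ : (i == a + 2) = false) ?muln0 ?addn0; last by apply/eqP; lia.
  by case: eqVneq => // ia; apply: f0; lia.
have ff' := finf _ _ _ f'0.
have e : (fun i => f i + doubled c' i)%N = (fun i => doubled c i + f' i)%N.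
  apply: funext => i; rewrite /doubled /c /c' /f' !subr_eq.
  rewrite (_ : a + 1 + 1 = a + 2); last by lia.
  have [->|ia] := eqVneq i a; last by rewrite muln0; lia.
  rewrite (_ : (a == a + 1) = false); last by apply/eqP; lia.
  rewrite (_ : (a == a + 2) = false); last by apply/eqP; lia.
  by rewrite !muln0 muln1 !addn0.
have Lf' : Lambda p (splitc R f') = 0.
  have := Lambda_splitcD ff (fin_supp_doubled fc').
  by rewrite e Lambda_splitcD ?Lambda_doubled ?Lf ?add0r //; apply: fin_supp_doubled.
have Cf' := IH _ _ f'0 Lf'.
apply: (tri_exactl C_tri (splitc_exact R f (doubled c'))); first exact: perfect_splitc.
  rewrite e; apply: (tri_exactm C_tri (splitc_exact R (doubled c) f')) => //.
    by apply: perfect_splitc; apply: fin_suppD => //; apply: fin_supp_doubled.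
  exact: tri_doubled.
exact: tri_doubled.
Qed.

Lemma splitc_null f : fin_supp f -> Lambda p (splitc R f) = 0 -> C (splitc R f).
Proof.
move=> [n fn]; apply: (@splitc_null_aux (2 * n)%N (- n%:Z)) => i lt_i.
by apply: fn; lia.
Qed.

(** Attaching the split complex of ranks [g] while adding a copy of it to the split part makes the
    quotient a doubled complex, which lies in [C]. *)
Lemma attach_exact X f g (u : chain_map (splitc R g) X) :
  split_exact (prodc X (splitc R f))
    (prodc (cone u) (splitc R (fun i => f i + g i)%N)) (splitc R (doubled g)).
Proof.
pose V n : lmodType R := (X n * 'rV[R]_(f n))%type.
pose W n : lmodType R := (('rV[R]_(g (n - 1)) * X n) * 'rV[R]_(f n + g n))%type.
pose Q n : lmodType R := 'rV[R]_(doubled g n).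
have il n : linear (fun z : V n => ((0, z.1), row_mx z.2 0) : W n).
  move=> a x y; apply/pair_eqP/andP; split; last first.
    by rewrite /= scale_row_mx add_row_mx scaler0 addr0.
  by apply/eqP/pair_eqP/andP; split; rewrite /= ?scaler0 ?addr0.
have ql n : linear (fun z : W n => row_mx z.1.1 (rsubmx z.2) : Q n).
  by move=> a x y; rewrite /= linearP scale_row_mx add_row_mx.
have rl n : linear (fun z : W n => (z.1.2, lsubmx z.2) : V n).
  by move=> a x y; apply/pair_eqP/andP; split; rewrite /= ?linearP.
have sl n : linear (fun w : Q n =>
   ((lsubmx (w : 'rV[R]_(g (n - 1)%R + g n)), 0),
     row_mx 0 (rsubmx (w : 'rV[R]_(g (n - 1)%R + g n)))) : W n).
  move=> a x y; apply/pair_eqP/andP; split; last first.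
    by rewrite /= linearP scale_row_mx add_row_mx scaler0 addr0.
  by apply/eqP/pair_eqP/andP; split; rewrite /= ?linearP ?scaler0 ?addr0.
have ic n m z : mk_linear (il m) (cdiff (prodc X (splitc R f)) n m z)
   = cdiff (prodc (cone u) (splitc R (fun i => f i + g i)%N)) n m (mk_linear (il n) z).
  apply/pair_eqP/andP; split; last by rewrite /= row_mx0.
  by apply/eqP/pair_eqP/andP; split; rewrite /= ?oppr0 ?linear0 ?add0r.
have qc n m z : mk_linear (ql m)
    (cdiff (prodc (cone u) (splitc R (fun i => f i + g i)%N)) n m z)
   = cdiff (splitc R (doubled g)) n m (mk_linear (ql n) z).
  by rewrite /= oppr0 linear0 row_mx0.
exists (@ChainMap _ (prodc X (splitc R f)) (prodc (cone u) (splitc R (fun i => f i + g i)%N)) _ ic)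
  (@ChainMap _ (prodc (cone u) (splitc R (fun i => f i + g i)%N)) (splitc R (doubled g)) _ qc)
  (fun n => mk_linear (rl n)) (fun n => mk_linear (sl n)) => n.
- by move=> [x a]; rewrite /= row_mxKl.
- by move=> w; rewrite /= row_mxKr hsubmxK.
move=> [[v x] a]; apply/pair_eqP/andP; split; last first.
  by rewrite /= row_mxKr add_row_mx addr0 add0r hsubmxK.
by apply/eqP/pair_eqP/andP; split; rewrite /= ?row_mxKl ?add0r ?addr0.
Qed.

Lemma tri_Lambda0 X : perfect X -> Lambda p X = 0 -> C X.
Proof.
move=> Xp LX.
have f0 : fin_supp (fun=> 0%N) by exists 0%N.
have S0 : zero_object (splitc R (fun=> 0%N)).
  by apply: trivial_zero_object => i x; apply: rV_trivial.
have CS0 : C (splitc R (fun=> 0%N)) by apply: (tri_zero C_tri) => //; apply: perfect_splitc.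
(* Attaching free modules changes [Lambda Y]; the variable split summand absorbs the change, so the
   induction needs all [f] of opposite characteristic. *)
suff H : forall Y, perfect Y -> forall f, fin_supp f ->
    Lambda p Y + Lambda p (splitc R f) = 0 -> C (prodc Y (splitc R f)).
  apply: (tri_exactl C_tri (prodc_exact X (splitc R (fun=> 0%N)))) => //.
  by apply: H; rewrite ?LX ?(Lambda_zero p_unique S0) ?addr0.
apply: (devissage p_unique) => [Y Yp Y0 f ff Lf|Y g u Yp fg IH f ff Lf].
  apply: (tri_exactm C_tri (prodc_exact Y (splitc R f))).
  - by apply: perfect_prodc => //; apply: perfect_splitc.
  - exact: (tri_zero C_tri).
  by apply: splitc_null => //; rewrite (Lambda_zero p_unique Y0) add0r in Lf.
have Sg := perfect_splitc R fg.
apply: (tri_exactl C_tri (attach_exact f u)); last exact: tri_doubled.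
  by apply: perfect_prodc => //; apply: perfect_splitc.
apply: IH; first exact: fin_suppD.
by rewrite (Lambda_cone p_unique) // Lambda_splitcD // addrACA addNr addr0.
Qed.

(** The cone of the zero map, [X[1] (+) Y], has [Lambda] zero and so lies in [C], as does [X[1]]. *)
Lemma tri_Lambda_eq X Y : C X -> perfect Y -> Lambda p X = Lambda p Y -> C Y.
Proof.
move=> CX Yp e; have Xp := tri_perfect C_tri CX.
apply: (tri_exactl C_tri (cone_split_exact (zeroc X Y))) => //.
  apply: tri_Lambda0; first exact: perfect_cone.
  by rewrite (Lambda_cone p_unique) // e subrr.
exact/(tri_shift C_tri).
Qed.

Lemma int_subgroup (G : int -> Prop) : G 0 -> (forall x y, G x -> G y -> G (x - y)) ->
  exists m : nat, forall x, G x <-> (x = 0 %[mod m%:Z])%Z.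
Proof.
move=> G0 GB.
have GN x : G x -> G (- x) by move=> Gx; rewrite -sub0r; apply: GB.
have GD x y : G x -> G y -> G (x + y) by move=> Gx Gy; rewrite -[y]opprK; apply: GB => //; apply: GN.
have GM (z : int) x : G x -> G (z * x).
  move=> Gx; have Gn (n : nat) : G (n%:Z * x).
    elim: n => [|n IH]; first by rewrite mul0r.
    by rewrite -addn1 PoszD mulrDl mul1r; apply: GD.
  case: z => n; first exact: Gn.
  by rewrite NegzE mulNr; apply/GN/Gn.
have [[n [n0 Gn]]|noG] := pselect (exists n : nat, (0 < n)%N /\ G n%:Z); last first.
  (* Without positive elements the subgroup is trivial, and congruence modulo [0] is equality. *)
  exists 0%N => x; rewrite modz0 mod0z; split=> [Gx|->//].
  apply: contrapT => x0; apply: noG; exists (absz x); split; first by lia.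
  by case: (lerP 0 x) => x0'; [rewrite gez0_abs | rewrite ltz0_abs //; apply: GN].
have exP : exists k, (0 < k)%N && `[< G k%:Z >] by exists n; rewrite n0; apply/asboolP.
case: (ex_minnP exP) => m /andP[m0 /asboolP Gm] mmin; exists m => x.
rewrite mod0z; split=> [Gx|xm]; last first.
  by rewrite (divz_eq x m) xm addr0; apply: GM.
have Gr : G (x %% m)%Z.
  have -> : (x %% m)%Z = x - (x %/ m)%Z * m%:Z.
    by rewrite {2}(divz_eq x m) addrAC subrr add0r.
  by apply: GB => //; apply: GM.
have r0 : (0 <= x %% m)%Z%R by apply: modz_ge0; lia.
have rm : (x %% m < m)%Z%R by apply: ltz_pmod; lia.
apply: contrapT => rn0; have := mmin (absz (x %% m)%Z).
rewrite (_ : (0 < absz (x %% m)%Z)%N && _ = true); first by lia.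
by apply/andP; split; [lia | apply/asboolP; rewrite gez0_abs].
Qed.

Lemma tri_classification : exists m : nat, forall X, C X <-> Dcat p m X.
Proof.
have [||m mP] := @int_subgroup (fun x => exists X, C X /\ Lambda p X = x).
- have f0 : fin_supp (fun=> 0%N) by exists 0%N.
  have S0 : zero_object (splitc R (fun=> 0%N)).
    by apply: trivial_zero_object => i x; apply: rV_trivial.
  exists (splitc R (fun=> 0%N)); split; last exact: (Lambda_zero p_unique).
  by apply: (tri_zero C_tri) => //; apply: perfect_splitc.
- move=> x y [X [CX <-]] [Y [CY <-]]; exists (cone (zeroc Y X)).
  split; first exact: tri_cone.
  by apply: (Lambda_cone p_unique); apply: (tri_perfect C_tri).
exists m => X; split=> [CX|[Xp /mP[Y [CY e]]]]; last exact: tri_Lambda_eq CY Xp e.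
by split; [apply: tri_perfect CX | apply/mP; exists X].
Qed.
End Classification.

Theorem proposition4p25 (R : comNzRingType) (p : prime_idealr R)
    (p_unique : forall q : prime_idealr R, q =i p)
    (C : complex R -> Prop) (C_tri : triangulated_subcategory C) :
  triangulated_ideal C /\
  ((exists X, C X /\ ~ zero_object X) ->
   exists m : nat, forall X, C X <-> Dcat p m X).
Proof.
split; last exact: tri_classification.
by split=> // X Y; apply: (tensc_ideal p_unique C_tri).
Qed.
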